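(* For $N\ge4$, the set $\mathcal B_2\cup\mathcal B_4$ is a Markov basis of the binary graphical model of the $N$-cycle $C_N$.
   Context: $C_N$ has vertex set $[N]=\{1,\dots,N\}$ and edges $\{i,i+1\}$ (indices mod $N$); all nodes are binary, so states are $x\in[2]^N$, $[2]=\{1,2\}$; $x_W=(x_v)_{v\in W}$. Let $\Bbbk$ be a field. Binomials $p^u-p^v$ in $\Bbbk[p_x:x\in[2]^N]$ are identified with moves $u-v\in\mathbb Z^{[2]^N}$. $A_{C_N}$ denotes the marginal matrix, $(A_{C_N}u)_{W,y}=\sum_{x:\,x_W=y}u_x$ for cliques $W$ of $C_N$ and $y\in[2]^W$. A finite set $\mathcal B\subset\ker_{\mathbb Z}A_{C_N}$ is a Markov basis of the graphical model if for all $u,v\in\mathbb N^{[2]^N}$ ($0\in\mathbb N$) with $A_{C_N}u=A_{C_N}v$ there is a finite sequence from $u$ to $v$ in $\mathbb N^{[2]^N}$ whose consecutive differences lie in $\pm\mathcal B$; equivalently, the binomials of $\mathcal B$ generate the toric ideal $I_{C_N}$, the kernel of $p_x\mapsto\prod_{W}\theta^W_{x_W}$ (product over the cliques $W$ of $C_N$, independent indeterminates $\theta^W_y$). $\mathcal B_2$: choose two non-adjacent vertices $i,j$ of $C_N$; removing them leaves two nonempty arcs $S,T$. For $a,b\in[2]$, $A\ne A'\in[2]^S$, $B\neq B'\in[2]^T$, $\mathcal B_2$ contains the quadric $$p_{(a,A,b,B)}p_{(a,A',b,B')}-p_{(a,A',b,B)}p_{(a,A,b,B')},$$ where $(a,A,b,B)$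 is the state equal to $a$ at $i$, $b$ at $j$, and restricting to $A$ on $S$ and $B$ on $T$. $\mathcal B_2$ consists of all these quadrics. $\mathcal B_4$: for a $\{1,2\}$-string $K$ let $\overline K$ be obtained by exchanging $1\leftrightarrow2$ in all positions. Partition the cyclically ordered set $[N]$ into three nonempty arcs (sets of cyclically consecutive vertices) $S_1,S_2,S_3$, and let $A\in[2]^{S_1},B\in[2]^{S_2},C\in[2]^{S_3}$. $\mathcal B_4$ consists of all quartics $$p_{ABC}\,p_{A\overline B\,\overline C}\,p_{\overline A B\overline C}\,p_{\overline A\,\overline B C}-p_{AB\overline C}\,p_{A\overline B C}\,p_{\overline A BC}\,p_{\overline A\,\overline B\,\overline C},$$ where $p_{ABC}$ is the variable indexed by the state restricting to $A,B,C$ on $S_1,S_2,S_3$. *)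

(* Defs.v *)
From HB Require Import structures.
From mathcomp Require Import all_boot all_order all_algebra.
From mathcomp Require Import boolp classical_sets cardinality.

Set Implicit Arguments.
Unset Strict Implicit.
Unset Printing Implicit Defensive.

Import GRing.Theory.
Local Open Scope ring_scope.

(* The two-element state space [2] = {1,2} is encoded by bool, so that the
   exchange 1 <-> 2 is negb; a graph is given by its edge relation. *)

Section GraphicalModel.
Variable V : finType.

Definition state : Type := {ffun V -> bool}.

Definition partial_state (W : {set V}) : Type :=
  {ffun {v : V | v \in W} -> bool}.

Definition restr (W : {set V}) (x : state) : partial_state W :=
  [ffun v => x (val v)].

Definition table : Type := {ffun state -> nat}.
Definition move : Type := {ffun state -> int}.

(* The empty set and the singletons are cliques. *)
Definition clique (e : rel V) (W : {set V}) : Prop :=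
  {in W &, forall v w, v != w -> e v w}.

(* The (W, y) entry of A u; tables and moves are the cases R = nat, int. *)
Definition marginal (R : nmodType) (u : {ffun state -> R})
    (W : {set V}) (y : partial_state W) : R :=
  \sum_(x : state | restr W x == y) u x.

Definition same_marginals (e : rel V) (u v : table) : Prop :=
  forall W : {set V}, clique e W ->
  forall y : partial_state W, marginal u y = marginal v y.

Definition in_kernel (e : rel V) (m : move) : Prop :=
  forall W : {set V}, clique e W ->
  forall y : partial_state W, marginal m y = 0.

Definition table_diff (u v : table) : move :=
  [ffun x => (u x)%:Z - (v x)%:Z].

Definition connected_by (B : set move) (u v : table) : Prop :=
  exists (n : nat) (w : nat -> table),
    [/\ w 0%N = u, w n = v &
        forall k, (k < n)%N ->
          B (table_diff (w k.+1) (w k)) \/ B (- table_diff (w k.+1) (w k))].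

Definition markov_basis (e : rel V) (B : set move) : Prop :=
  [/\ finite_set B,
      forall m, B m -> in_kernel e m &
      forall u v : table, same_marginals e u v -> connected_by B u v].

(* The exponent vector of the variable p_x. *)
Definition pvar (x : state) : move := [ffun z => (z == x)%:R].

Definition patch (W : {set V}) (y : partial_state W) (x : state) : state :=
  [ffun v => if insub v is Some w then y w else x v].

Definition compl (W : {set V}) (y : partial_state W) : partial_state W :=
  [ffun v => ~~ y v].

Lemma patch_in (W : {set V}) (y : partial_state W) x v (vW : v \in W) :
  patch y x v = y (Sub v vW).
Proof. by rewrite ffunE insubT. Qed.

Lemma patch_out (W : {set V}) (y : partial_state W) x v :
  v \notin W -> patch y x v = x v.
Proof. by move=> vW; rewrite ffunE insubN. Qed.

End GraphicalModel.

Section Cycle.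
Variable N : nat.
Implicit Types i j k : 'I_N.

Definition cycle_adj : rel 'I_N :=
  fun i j => (j == i.+1 %[mod N]) || (i == j.+1 %[mod N]).

(* The number of steps from i to k in the direction 0, 1, 2, ... *)
Definition cdist i k : nat := ((k + N - i) %% N)%N.

(* The vertices strictly between i and j in that direction: for distinct i, j,
   removing i and j from the cycle leaves between i j and between j i. *)
Definition between i j : {set 'I_N} := [set k | 0 < cdist i k < cdist i j]%N.

(* The set of vertices i, i + 1, ..., i + l - 1 modulo N. *)
Definition arc i (l : nat) : {set 'I_N} := [set k | cdist i k < l]%N.

Definition is_arc (S : {set 'I_N}) : Prop := exists i l, S = arc i l.

(* The state (a, A, b, B). *)
Definition glue2 i j (a b : bool) (A : partial_state (between i j))
    (B : partial_state (between j i)) : state 'I_N :=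
  patch A (patch B [ffun k => if k == i then a else b]).

Definition quadric i j (a b : bool) (A A' : partial_state (between i j))
    (B B' : partial_state (between j i)) : move 'I_N :=
  pvar (glue2 a b A B) + pvar (glue2 a b A' B')
  - (pvar (glue2 a b A' B) + pvar (glue2 a b A B')).

Definition B2 : set (move 'I_N) := fun m =>
  exists i j, [/\ i != j, ~~ cycle_adj i j &
    exists (a b : bool) (A A' : partial_state (between i j))
      (B B' : partial_state (between j i)),
      [/\ A != A', B != B' & m = quadric a b A A' B B']].

Definition arc_partition3 (S1 S2 S3 : {set 'I_N}) : Prop :=
  [/\ [/\ is_arc S1, is_arc S2 & is_arc S3],
      [/\ S1 != finset.set0, S2 != finset.set0 & S3 != finset.set0],
      [/\ [disjoint S1 & S2], [disjoint S1 & S3] & [disjoint S2 & S3]] &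
      S1 :|: S2 :|: S3 = [set: 'I_N]].

(* The state (A, B, C); the constant false is immaterial, as the three sets
   are only used when they cover 'I_N. *)
Definition glue3 (S1 S2 S3 : {set 'I_N}) (A : partial_state S1)
    (B : partial_state S2) (C : partial_state S3) : state 'I_N :=
  patch A (patch B (patch C [ffun=> false])).

Definition quartic (S1 S2 S3 : {set 'I_N}) (A : partial_state S1)
    (B : partial_state S2) (C : partial_state S3) : move 'I_N :=
  let p A B C := pvar (glue3 A B C) in
  let A' := compl A in let B' := compl B in let C' := compl C in
  (p A B C + p A B' C' + p A' B C' + p A' B' C)
  - (p A B C' + p A B' C + p A' B C + p A' B' C').

Definition B4 : set (move 'I_N) := fun m =>
  exists S1 S2 S3, arc_partition3 S1 S2 S3 /\
    exists (A : partial_state S1) (B : partial_state S2) (C : partial_state S3),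
      m = quartic A B C.

End Cycle.

Arguments cycle_adj : clear implicits.
Arguments B2 : clear implicits.
Arguments B4 : clear implicits.

(* Main.v *)
Require Import Defs.
From mathcomp Require Import all_boot all_order all_algebra.
From mathcomp Require Import boolp classical_sets cardinality.
From mathcomp Require Import all_fingroup zify ring.

(** List the observations of a table as rows, so that a quadric exchanges two
    rows on one of the two arcs between columns where they agree, and hence,
    by composition, rows may be permuted arbitrarily on such an arc within the
    classes given by the entries at its two ends.  For two tables with the same
    margins, sort the rows so that they agree on the columns 0, m + 1, ..., N - 1,
    and decrease m.  It suffices to make the margins on the triple {0, m, m + 1}
    agree: then the tables can be glued along this triangle.  As the margins on
    {0, m + 1} and {m, m + 1} agree, the triple margins differ by at most two
    parameters: the number of rows with entry 1 at 0 and m, and the number of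
    rows with entry 1 at 0, m and m + 1.  The first is corrected by quadrics
    alone, because the edge margins fix the total number of sign changes between
    consecutive columns.  The second needs four rows realising the four odd
    triples; conjugation by quadrics brings the columns of these four rows
    into three blocks, and then a quartic applies. *)

(** * The two families of moves: kernel membership and finiteness *)

Section Kernel.

Set Implicit Arguments.
Unset Strict Implicit.
Unset Printing Implicit Defensive.
Import GRing.Theory.

Lemma restr_eq (V : finType) (W : {set V}) (x y : state V) :
  {in W, x =1 y} -> restr W x = restr W y.
Proof. by move=> xy; apply/ffunP => v; rewrite !ffunE xy ?(valP v). Qed.

Lemma restr_inj (V : finType) (W : {set V}) (x y : state V) :
  restr W x = restr W y -> {in W, x =1 y}.
Proof.
by move=> /ffunP xy v vW; have := xy (Sub v vW); rewrite !ffunE /=.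
Qed.

Section Marginals.
Variables (V : finType) (W : {set V}) (y : partial_state W).
Implicit Types m : move V.

Lemma marginal_pvar x : marginal (pvar x) y = (restr W x == y)%:R%R.
Proof.
rewrite /marginal big_mkcond (bigD1 x) //= ffunE eqxx big1 ?addr0.
  by case: ifP.
by move=> z /negPf zx; rewrite ffunE zx; case: ifP.
Qed.

Lemma marginalD m1 m2 :
  (marginal (m1 + m2) y = marginal m1 y + marginal m2 y)%R.
Proof. by rewrite -big_split; apply: eq_bigr => x _; rewrite ffunE. Qed.

Lemma marginalN m : (marginal (- m) y = - marginal m y)%R.
Proof. by rewrite -sumrN; apply: eq_bigr => x _; rewrite ffunE. Qed.

End Marginals.

Lemma marginal_table_diff (V : finType) (W : {set V}) (y : partial_state W)
    (u v : table V) :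
  marginal (table_diff u v) y = ((marginal u y)%:Z - (marginal v y)%:Z)%R.
Proof.
rewrite /marginal.
under eq_bigr => x _ do rewrite ffunE.
by rewrite sumrB -!(big_morph Posz PoszD (erefl _)).
Qed.

(** Removes the modulus, so that adjacency becomes a matter for [lia]. *)
Lemma cycle_adjE N (i j : 'I_N) : 1 < N -> cycle_adj N i j =
  [|| j == i.+1 :> nat, i == j.+1 :> nat,
      (i == 0 :> nat) && (j.+1 == N) | (j == 0 :> nat) && (i.+1 == N)].
Proof.
move=> hN; rewrite /cycle_adj !(modn_small (ltn_ord _)).
have sE (k l : 'I_N) :
    (l == k.+1 %% N :> nat) = (l == k.+1 :> nat) || (l == 0 :> nat) && (k.+1 == N).
  have [kN|] := ltnP k.+1 N.
    by rewrite modn_small // (ltn_eqF kN) andbF orbF.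
  rewrite leq_eqVlt ltnNge ltn_ord orbF => /eqP kN.
  rewrite (_ : k.+1 %% N = 0); last by rewrite -kN modnn.
  by rewrite -kN eqxx andbT (ltn_eqF (ltn_ord l)).
rewrite !sE; case: (j == i.+1 :> nat); case: (i == j.+1 :> nat) => //=.
  by rewrite orbT.
by rewrite orbC.
Qed.

Lemma cdistE N (i k : 'I_N) :
  cdist i k = if i <= k then k - i else k + N - i.
Proof.
have := (ltn_ord i, ltn_ord k); rewrite /cdist => -[iN kN].
case: leqP => ik; last by rewrite modn_small //; lia.
by rewrite addnC -addnBA // modnDl modn_small //; lia.
Qed.

(** The second case is the arc that wraps around past [N - 1]. *)
Lemma betweenE N (i j k : 'I_N) : i != j -> k \in between i j =
  if i < j then i < k < j else (i < k) || (k < j).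
Proof.
have := (ltn_ord i, ltn_ord k, ltn_ord j) => -[[iN kN] jN].
rewrite -val_eqE /= => ij; rewrite inE !cdistE.
by case: (leqP i k); case: (leqP i j); case: (ltnP i j); lia.
Qed.

Section Glue.
Variables (N : nat).
Implicit Types (v : 'I_N) (S : {set 'I_N}).

Lemma glue2_in1 i j a b (A : partial_state (between i j))
    (B : partial_state (between j i)) v (h : v \in between i j) :
  glue2 a b A B v = A (Sub v h).
Proof. exact: patch_in. Qed.

Lemma glue2_in2 i j a b (A : partial_state (between i j))
    (B : partial_state (between j i)) v (h : v \in between j i) :
  v \notin between i j -> glue2 a b A B v = B (Sub v h).
Proof. by move=> h1; apply: etrans (patch_in _ _ h); apply: patch_out. Qed.

Lemma glue2_out i j a b (A : partial_state (between i j))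
    (B : partial_state (between j i)) v :
    v \notin between i j -> v \notin between j i ->
  glue2 a b A B v = if v == i then a else b.
Proof.
move=> h1 h2; apply: etrans (_ : _ = patch B _ v) _; first exact: patch_out.
by apply: etrans (patch_out _ _ h2) _; rewrite ffunE.
Qed.

Lemma glue3_in1 S1 S2 S3 (A : partial_state S1) (B : partial_state S2)
    (C : partial_state S3) v (h : v \in S1) : glue3 A B C v = A (Sub v h).
Proof. exact: patch_in. Qed.

Lemma glue3_in2 S1 S2 S3 (A : partial_state S1) (B : partial_state S2)
    (C : partial_state S3) v (h : v \in S2) :
  v \notin S1 -> glue3 A B C v = B (Sub v h).
Proof. by move=> h1; apply: etrans (patch_in _ _ h); apply: patch_out. Qed.

Lemma glue3_in3 S1 S2 S3 (A : partial_state S1) (B : partial_state S2)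
    (C : partial_state S3) v (h : v \in S3) :
  v \notin S1 -> v \notin S2 -> glue3 A B C v = C (Sub v h).
Proof.
move=> h1 h2; apply: etrans (patch_in _ _ h).
by apply: etrans (patch_out _ _ h1) _; apply: patch_out.
Qed.

Lemma glue3_out S1 S2 S3 (A : partial_state S1) (B : partial_state S2)
    (C : partial_state S3) v :
  v \notin S1 -> v \notin S2 -> v \notin S3 -> glue3 A B C v = false.
Proof.
move=> h1 h2 h3; apply: etrans (patch_out _ _ h1) _.
by apply: etrans (patch_out _ _ h2) _; apply: etrans (patch_out _ _ h3) (ffunE _ _).
Qed.

End Glue.

Section CycleKernel.
Variable N : nat.
Hypothesis hN : 3 < N.

(** Three distinct pairwise adjacent vertices exist only in the cycle of length 3, which [3 < N]
    excludes. *)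
Lemma clique_triangle_free (W : {set 'I_N}) a b c :
    clique (cycle_adj N) W -> a \in W -> b \in W -> c \in W ->
  a != b -> a != c -> b != c -> False.
Proof.
move=> cW aW bW cW' ab ac bc.
have := cW _ _ aW bW ab; have := cW _ _ aW cW' ac; have := cW _ _ bW cW' bc.
have h : 1 < N by apply: leq_trans hN.
rewrite !cycle_adjE //; move: ab ac bc; rewrite -!val_eqE /=.
by have := (ltn_ord a, ltn_ord b, ltn_ord c) => -[[]] ? ? ?; lia.
Qed.

(** No edge joins the two arcs that remain after removing [i] and [j]. *)
Lemma clique_between (W : {set 'I_N}) i j k l :
    clique (cycle_adj N) W -> i != j -> k \in W -> k \in between i j ->
  l \in W -> l \notin between j i.
Proof.
move=> cW ij kW kB lW; apply/negP => lB.
have h : 1 < N by apply: leq_trans hN.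
have kl : k != l.
  apply/eqP => kl; move: kB lB; rewrite kl !betweenE //; last by rewrite eq_sym.
  by move: ij; rewrite -val_eqE /=; case: ltngtP => //=; lia.
have := cW _ _ kW lW kl; rewrite cycle_adjE //.
move: kB lB; rewrite !betweenE //; last by rewrite eq_sym.
have := (ltn_ord i, ltn_ord k, ltn_ord j, ltn_ord l) => -[[[]]] ? ? ? ?.
by move: ij; rewrite -val_eqE /=; case: ltngtP => //=; lia.
Qed.

(** A clique misses one of the two arcs, so its restriction ignores the part chosen on that arc.
    Terms of opposite sign then cancel in pairs. *)
Lemma B2_kernel (m : move 'I_N) : B2 N m -> in_kernel (cycle_adj N) m.
Proof.
move=> [i [j [ij _ [a [b [A [A' [B [B' [_ _ ->]]]]]]]]]] W cW y.
rewrite /quadric !(marginalD, marginalN, marginal_pvar).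
case: (boolP [disjoint W & between i j]) => [dW|/pred0Pn[k /andP[/= kW kB]]].
  have e (C D : partial_state (between i j)) (E : partial_state (between j i)) :
      restr W (glue2 a b C E) = restr W (glue2 a b D E).
    apply: restr_eq => v vW; have v1 := negbT (disjointFr dW vW).
    case: (boolP (v \in between j i)) => v2;
      first by apply: etrans (glue2_in2 _ _ _ _ v2 v1)
        (esym (glue2_in2 _ _ _ _ v2 v1)).
    by apply: etrans (glue2_out _ _ _ _ v1 v2)
        (esym (glue2_out _ _ _ _ v1 v2)).
  by rewrite (e A A' B) (e A A' B'); ring.
have e (C D : partial_state (between j i)) (E : partial_state (between i j)) :
    restr W (glue2 a b E C) = restr W (glue2 a b E D).
  apply: restr_eq => v vW.
  case: (boolP (v \in between i j)) => vB;
      first by apply: etrans (glue2_in1 _ _ _ _ vB)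
        (esym (glue2_in1 _ _ _ _ vB)).
  have vB' := clique_between cW ij kW kB vW.
  by apply: etrans (glue2_out _ _ _ _ vB vB')
        (esym (glue2_out _ _ _ _ vB vB')).
by rewrite (e B B' A) (e B B' A'); ring.
Qed.

(** Complementing one arc pairs each positive term with a negative one, and a clique misses some
    arc, since meeting all three would give a triangle. *)
Lemma B4_kernel (m : move 'I_N) : B4 N m -> in_kernel (cycle_adj N) m.
Proof.
move=> [S1 [S2 [S3 [[_ _ [d12 d13 d23] _] [A [B [C ->]]]]]]] W cW y.
rewrite /quartic !(marginalD, marginalN, marginal_pvar).
case: (boolP [disjoint W & S1]) => [dW|/pred0Pn[a /andP[/= aW a1]]].
  have e (X X' : partial_state S1) (Y : partial_state S2) (Z : partial_state S3) :
      restr W (glue3 X Y Z) = restr W (glue3 X' Y Z).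
    apply: restr_eq => v vW; have vS := negbT (disjointFr dW vW).
    case: (boolP (v \in S2)) => v2;
      first by apply: etrans (glue3_in2 _ _ _ v2 vS)
        (esym (glue3_in2 _ _ _ v2 vS)).
    case: (boolP (v \in S3)) => v3;
      first by apply: etrans (glue3_in3 _ _ _ v3 vS v2)
        (esym (glue3_in3 _ _ _ v3 vS v2)).
    by apply: etrans (glue3_out _ _ _ vS v2 v3)
        (esym (glue3_out _ _ _ vS v2 v3)).
  by rewrite !(e (compl A) A); ring.
case: (boolP [disjoint W & S2]) => [dW|/pred0Pn[b /andP[/= bW b2]]].
  have e (X : partial_state S1) (Y Y' : partial_state S2) (Z : partial_state S3) :
      restr W (glue3 X Y Z) = restr W (glue3 X Y' Z).
    apply: restr_eq => v vW; have vS := negbT (disjointFr dW vW).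
    case: (boolP (v \in S1)) => v1;
      first by apply: etrans (glue3_in1 _ _ _ v1)
        (esym (glue3_in1 _ _ _ v1)).
    case: (boolP (v \in S3)) => v3;
      first by apply: etrans (glue3_in3 _ _ _ v3 v1 vS)
        (esym (glue3_in3 _ _ _ v3 v1 vS)).
    by apply: etrans (glue3_out _ _ _ v1 vS v3)
        (esym (glue3_out _ _ _ v1 vS v3)).
  by rewrite !(e _ (compl B) B); ring.
case: (boolP [disjoint W & S3]) => [dW|/pred0Pn[c /andP[/= cW' c3]]].
  have e (X : partial_state S1) (Y : partial_state S2) (Z Z' : partial_state S3) :
      restr W (glue3 X Y Z) = restr W (glue3 X Y Z').
    apply: restr_eq => v vW; have vS := negbT (disjointFr dW vW).
    case: (boolP (v \in S1)) => v1;
      first by apply: etrans (glue3_in1 _ _ _ v1)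
        (esym (glue3_in1 _ _ _ v1)).
    case: (boolP (v \in S2)) => v2;
      first by apply: etrans (glue3_in2 _ _ _ v2 v1)
        (esym (glue3_in2 _ _ _ v2 v1)).
    by apply: etrans (glue3_out _ _ _ v1 v2 vS)
        (esym (glue3_out _ _ _ v1 v2 vS)).
  by rewrite !(e _ _ (compl C) C); ring.
exfalso; apply: (clique_triangle_free cW aW bW cW').
- by apply: contraTneq a1 => ->; rewrite (disjointFl d12 b2).
- by apply: contraTneq a1 => ->; rewrite (disjointFl d13 c3).
- by apply: contraTneq b2 => ->; rewrite (disjointFl d23 c3).
Qed.

End CycleKernel.

Lemma finite_B2 N : finite_set (B2 N).
Proof.
pose f (p : state 'I_N * state 'I_N * (state 'I_N * state 'I_N)) :=
  (pvar p.1.1 + pvar p.1.2 - (pvar p.2.1 + pvar p.2.2))%R.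
apply: sub_finite_set (finite_image f (@finite_finset _ setT)).
move=> m [i [j [_ _ [a [b [A [A' [B [B' [_ _ ->]]]]]]]]]].
by exists (glue2 a b A B, glue2 a b A' B', (glue2 a b A' B, glue2 a b A B')).
Qed.

Lemma finite_B4 N : finite_set (B4 N).
Proof.
(* Each index carries a positive term of the quartic as first component and a negative one as
   second. *)
pose f (p : 'I_4 -> state 'I_N * state 'I_N) :=
  (pvar (p 0%R).1 + pvar (p 1%R).1 + pvar (p 2%R).1 + pvar (p 3%R).1
   - (pvar (p 0%R).2 + pvar (p 1%R).2 + pvar (p 2%R).2 + pvar (p 3%R).2))%R.
pose g (p : {ffun 'I_4 -> state 'I_N * state 'I_N}) := f p.
apply: sub_finite_set (finite_image g (@finite_finset _ setT)).
move=> m [S1 [S2 [S3 [_ [A [B [C ->]]]]]]].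
pose q := [:: (glue3 A B C, glue3 A B (compl C));
  (glue3 A (compl B) (compl C), glue3 A (compl B) C);
  (glue3 (compl A) B (compl C), glue3 (compl A) B C);
  (glue3 (compl A) (compl B) C, glue3 (compl A) (compl B) (compl C))].
exists [ffun r : 'I_4 => nth (glue3 A B C, glue3 A B C) q r] => //.
by rewrite /g /f !ffunE.
Qed.

End Kernel.

(** * Connectivity by moves as an equivalence relation *)

Section Connected.

Set Implicit Arguments.
Unset Strict Implicit.
Unset Printing Implicit Defensive.
Import GRing.Theory.

Lemma table_diffC (V : finType) (u v : table V) :
  table_diff u v = (- table_diff v u)%R.
Proof. by apply/ffunP => x; rewrite !ffunE opprB. Qed.

Variables (V : finType) (B : set (move V)).
Implicit Types u v w : table V.

Lemma connected_refl u : connected_by B u u.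
Proof. by exists 0, (fun=> u); split. Qed.

Lemma connected_step u v :
  B (table_diff v u) \/ B (- table_diff v u)%R -> connected_by B u v.
Proof. by move=> h; exists 1, (fun k => if k is 0 then u else v); split=> // -[]. Qed.

Lemma connected_trans v u w :
  connected_by B u v -> connected_by B v w -> connected_by B u w.
Proof.
move=> [n [f [f0 fn hf]]] [m [g [g0 gm hg]]].
exists (n + m), (fun k => if k <= n then f k else g (k - n)); split=> //=.
  case: leqP; last by rewrite addKn.
  by rewrite -{2}(addn0 n) leq_add2l leqn0 => /eqP m0; rewrite m0 addn0 fn -g0 -gm m0.
move=> k; have [kn|nk|->] := ltngtP k n => h; first exact: hf.
  have -> : k.+1 - n = (k - n).+1 by rewrite subSn // ltnW.
  by apply: hg; rewrite ltn_subLR // ltnW.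
by rewrite subSnn fn -g0; apply: hg; move: h; rewrite -{1}(addn0 n) ltn_add2l.
Qed.

Lemma connected_sym u v : connected_by B u v -> connected_by B v u.
Proof.
move=> [n [f [f0 fn hf]]]; exists n, (fun k => f (n - k)).
rewrite subn0 subnn; split=> // k kn.
have := hf (n - k.+1); rewrite subnSK // => /(_ (leq_subr _ _)).
by rewrite (table_diffC (f (n - k))) opprK => -[]; [right|left].
Qed.

End Connected.

(** * Tables as lists of rows, and the exchange of two rows by a quadric *)

Section Rows.

Set Implicit Arguments.
Unset Strict Implicit.
Unset Printing Implicit Defensive.
Import GRing.Theory.

Variable N : nat.
Hypothesis hN : 3 < N.

(** Rows are functions on [nat], so that columns can be handled by plain arithmetic; only the
    columns below [N] reach the state. *)
Definition st (x : nat -> bool) : state 'I_N := [ffun c : 'I_N => x c].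

Lemma st_eq x y : (forall c, c < N -> x c = y c) -> st x = st y.
Proof. by move=> xy; apply/ffunP => c; rewrite !ffunE xy. Qed.

Lemma glue2_st (i j : 'I_N) (x y z : nat -> bool) : i != j ->
    (forall c : 'I_N, c \in between i j -> z c = x c) ->
    (forall c : 'I_N, c \in between j i -> z c = y c) ->
  glue2 (z i) (z j) (restr (between i j) (st x)) (restr (between j i) (st y))
  = st z.
Proof.
move=> ij zx zy; apply/ffunP => c; apply: etrans (_ : z c = _); last by rewrite ffunE.
have [h1|h1] := boolP (c \in between i j).
  by apply: etrans (glue2_in1 _ _ _ _ h1) _; rewrite !ffunE zx.
have [h2|h2] := boolP (c \in between j i).
  by apply: etrans (glue2_in2 _ _ _ _ h2 h1) _; rewrite !ffunE zy.
apply: etrans (glue2_out _ _ _ _ h1 h2) _.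
have [->//|ci] := eqVneq c i.
have -> // : c = j; apply: val_inj => /=.
move: h1 h2; rewrite !betweenE //; last by rewrite eq_sym.
by move: ij ci; rewrite -!val_eqE /=; case: (ltngtP i j); lia.
Qed.

Variable n : nat.
Implicit Types u v : 'I_n -> nat -> bool.

Definition tab u : table 'I_N := [ffun s => \sum_(r < n) (st (u r) == s)].

Definition conn u v := connected_by (B2 N `|` B4 N)%classic (tab u) (tab v).

Lemma conn_refl u : conn u u. Proof. exact: connected_refl. Qed.

Lemma conn_trans v u w : conn u v -> conn v w -> conn u w.
Proof. exact: connected_trans. Qed.

Lemma conn_sym u v : conn u v -> conn v u.
Proof. exact: connected_sym. Qed.

Lemma conn_eq u v : (forall r c, c < N -> u r c = v r c) -> conn u v.
Proof.
move=> uv; rewrite /conn (_ : tab u = tab v); first exact: connected_refl.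
by apply/ffunP => s; rewrite !ffunE; apply: eq_bigr => r _; rewrite (st_eq (uv r)).
Qed.

(** A table does not record the order of its rows, so reordering costs no move. *)
Lemma conn_perm u (s : {perm 'I_n}) : conn u (fun r => u (s r)).
Proof.
rewrite /conn (_ : tab u = tab (fun r => u (s r))); first exact: connected_refl.
by apply/ffunP => x; rewrite !ffunE (reindex_perm s).
Qed.

Lemma conn_inj u f : injective f -> conn u (fun r => u (f r)).
Proof.
move=> fI; apply: conn_trans (conn_perm u (perm fI)) _; apply: conn_eq => r c _.
by rewrite permE.
Qed.

Lemma table_diff_tab u v :
  table_diff (tab v) (tab u) = (\sum_r (pvar (st (v r)) - pvar (st (u r))))%R.
Proof.
apply/ffunP => s; rewrite !ffunE sum_ffunE !(big_morph Posz PoszD (erefl _)).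
rewrite -sumrB; apply: eq_bigr => r _; rewrite !ffunE ![s == _]eq_sym.
by case: (_ == s); case: (_ == s).
Qed.

Definition swp (D : pred nat) (f : 'I_n -> 'I_n) u : 'I_n -> nat -> bool :=
  fun r c => if D c then u (f r) c else u r c.

Definition inner i j : pred nat := fun c => i < c < j.

Definition tw (a b r : 'I_n) := if r == a then b else if r == b then a else r.

Lemma twl a b : tw a b a = b. Proof. by rewrite /tw eqxx. Qed.

Lemma twr a b : tw a b b = a. Proof. by rewrite /tw eqxx; case: eqVneq. Qed.

Lemma tw_out a b r : r != a -> r != b -> tw a b r = r.
Proof. by rewrite /tw => /negPf -> /negPf ->. Qed.

Lemma twK a b : involutive (tw a b).
Proof.
move=> r; have [->|ra] := eqVneq r a; first by rewrite twl twr.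
have [->|rb] := eqVneq r b; first by rewrite twr twl.
by rewrite !tw_out.
Qed.

(** One quadric performs the exchange, unless the two rows agree on one of the arcs cut out by
    columns [i] and [j]. *)
Lemma conn_swap u a b i j : i < j -> j < N ->
    u a i = u b i -> u a j = u b j ->
  conn u (swp (inner i j) (tw a b) u).
Proof.
move=> ij jN ui uj.
have [<-|ab] := eqVneq a b.
  by apply: conn_eq => r c _; rewrite /swp /tw; case: ifP => //; case: eqVneq => // ->.
have iN := ltn_trans ij jN.
pose I := Ordinal iN; pose J := Ordinal jN.
have IJ : I != J by rewrite -val_eqE /= (ltn_eqF ij).
pose R1 x := restr (between I J) (st x); pose R2 x := restr (between J I) (st x).
have inIJ (c : 'I_N) : (c \in between I J) = (i < c < j) by rewrite betweenE //= ij.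
have inJI (c : 'I_N) : (c \in between J I) = (j < c) || (c < i).
  by rewrite betweenE 1?eq_sym //= ltnNge (ltnW ij).
case: (eqVneq (R1 (u a)) (R1 (u b))) => [/restr_inj e|nA].
  have {}e c : i < c < j -> u a c = u b c.
    move=> h; have cN : c < N by case/andP: h => _ h; apply: ltn_trans h jN.
    by have := e (Ordinal cN); rewrite !ffunE; apply; rewrite inIJ.
  apply: conn_eq => r c _; rewrite /swp; case: ifP => // h.
  by rewrite /tw; case: eqVneq => [->|_]; [rewrite e|case: eqVneq => // ->; rewrite e].
(* For rows that agree on the outer arc, the exchange amounts to swapping the two rows in the
   list. *)
case: (eqVneq (R2 (u a)) (R2 (u b))) => [/restr_inj e|nB].
  have {}e c : c < N -> ~~ (i < c < j) -> u a c = u b c.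
    move=> cN h; have [->//|ci] := eqVneq c i; have [->//|cj] := eqVneq c j.
    have := e (Ordinal cN); rewrite !ffunE; apply; rewrite inJI /=; lia.
  apply: conn_trans (conn_inj u (inv_inj (twK a b))) _; apply: conn_eq => r c cN.
  rewrite /swp; case: ifP => // /negbT h.
  by rewrite /tw; case: eqVneq => [->|_]; [rewrite e|case: eqVneq => // ->; rewrite e].
(* The positive terms of the quadric are the old rows, so the step is minus the quadric. *)
apply: connected_step; right; left; exists I, J; split => //.
  (* For adjacent columns one of the two arcs would be empty, and the rows would agree on it. *)
  rewrite cycle_adjE /=; last exact: ltnW (ltnW hN).
  apply/negP => h; have [/eqP jE|/andP[/eqP i0 /eqP jN1]] :
    j == i.+1 \/ (i == 0) && (j.+1 == N) by lia.
  - move/eqP: nA; apply; apply: restr_eq => c; rewrite inIJ => hc; exfalso; lia.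
  - move/eqP: nB; apply; apply: restr_eq => c; rewrite inJI => hc.
    by exfalso; have := ltn_ord c; lia.
exists (u a i), (u a j), (R1 (u a)), (R1 (u b)), (R2 (u a)), (R2 (u b)).
split=> //; rewrite table_diff_tab (bigD1 a) //= (bigD1 b) 1?eq_sym //=.
rewrite big1 ?addr0; last first.
  move=> r /andP[ra rb]; rewrite (@st_eq (swp _ _ _ _) (u r)) ?subrr // => c _.
  by rewrite /swp tw_out // if_same.
have g x y z : z i = u a i -> z j = u a j ->
    (forall c, i < c < j -> z c = x c) -> (forall c, (j < c) || (c < i) -> z c = y c) ->
    glue2 (u a i) (u a j) (R1 x) (R2 y) = st z.
  move=> <- <- h1 h2; apply: (@glue2_st I J) => // c; first by rewrite inIJ => /h1.
  by rewrite inJI => /h2.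
rewrite /quadric (g _ _ (u a)) // (g _ _ (u b)) //.
rewrite (g _ _ (swp (inner i j) (tw a b) u a)); first last.
- by move=> c h; rewrite /swp /inner /= ifF //; lia.
- by move=> c h; rewrite /swp /inner /= h twl.
- by rewrite /swp /inner /= ltnn andbF.
- by rewrite /swp /inner /= ltnn.
rewrite (g _ _ (swp (inner i j) (tw a b) u b)); first last.
- by move=> c h; rewrite /swp /inner /= ifF //; lia.
- by move=> c h; rewrite /swp /inner /= h twr.
- by rewrite /swp /inner /= ltnn andbF uj.
- by rewrite /swp /inner /= ltnn ui.
by apply/ffunP => s; rewrite !ffunE; ring.
Qed.

End Rows.

(** * Permutations of rows on an arc, and the quartic as a simultaneous exchange of two pairs *)

Section Flips.

Set Implicit Arguments.
Unset Strict Implicit.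
Unset Printing Implicit Defensive.
Import GRing.Theory.

Variables (N n : nat).
Hypothesis hN : 3 < N.
Implicit Types u v : 'I_n -> nat -> bool.
Local Notation conn := (@conn N n).

Lemma conn_ext D f g u : f =1 g -> conn u (swp D f u) -> conn u (swp D g u).
Proof. by move=> fg /conn_trans; apply; apply: conn_eq => r c _; rewrite /swp fg. Qed.

Lemma swp_in (D : pred nat) f u r c : D c -> swp D f u r c = u (f r) c.
Proof. by rewrite /swp => ->. Qed.

Lemma swp_out (D : pred nat) f u r c : ~~ D c -> swp D f u r c = u r c.
Proof. by rewrite /swp => /negPf ->. Qed.

(* The swap of two rows acts on columns disjoint from D, so it commutes with
   the permutation performed on D and cancels. *)
Lemma conn_conj (D : pred nat) f a b i j u : i < j < N ->
    (forall c, inner i j c -> ~~ D c) ->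
    u a i = u b i -> u a j = u b j ->
    swp D f u a i = swp D f u b i -> swp D f u a j = swp D f u b j ->
    conn (swp (inner i j) (tw a b) u) (swp D f (swp (inner i j) (tw a b) u)) ->
  conn u (swp D f u).
Proof.
move=> /andP[ij jN] dD ui uj wi wj h.
apply: conn_trans (conn_swap hN ij jN ui uj) _; apply: conn_trans h _.
apply: conn_trans (conn_swap hN (a := a) (b := b) ij jN _ _) _.
- by move: wi; rewrite /swp /inner /= ltnn.
- by move: wj; rewrite /swp /inner /= ltnn andbF.
apply: conn_eq => r c _; rewrite /swp.
by have [h|h] := boolP (inner i j c); [rewrite (negPf (dD c h)) twK|].
Qed.

(** Exchanging rows on [D1] and then reordering whole rows by the involution [f] exchanges them off
    [D1]. Hence [D2] may be the complement of [D1], up to columns that [f] leaves invariant. *)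
Lemma conn_compl (D1 D2 : pred nat) f u : involutive f ->
    (forall r c, c < N -> D1 c = D2 c -> u (f r) c = u r c) ->
  conn u (swp D1 f u) -> conn u (swp D2 f u).
Proof.
move=> fK h /conn_trans; apply.
apply: conn_trans (conn_inj _ _ (inv_inj fK)) _; apply: conn_eq => r c cN.
have := h r c cN; rewrite /swp fK.
by case: (D1 c); case: (D2 c) => // ->.
Qed.

(** Induction on the number of rows that [s] moves: a transposition is split off, and it is realised
    by one exchange of two rows. *)
Lemma conn_glue u (s : {perm 'I_n}) i j : i < j < N ->
    (forall r, u (s r) i = u r i) -> (forall r, u (s r) j = u r j) ->
  conn u (swp (inner i j) s u).
Proof.
move=> ijN; have [m] := ubnP #|[pred r | s r != r]|.
elim: m s => // m IH s; rewrite ltnS => sm si sj.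
have [r /= sr|s1] := pickP [pred r | s r != r]; last first.
  by apply: conn_eq => r c _; have /negbFE/eqP e := s1 r; rewrite /swp e if_same.
(* This permutation fixes [s r] as well as every row fixed by [s]. *)
pose s' := (tperm r (s r) * s)%g.
have s'E x : s' x = s (tw r (s r) x).
  rewrite permM; congr (s _); rewrite /tw.
  by case: tpermP => [->|->|/eqP/negPf -> /eqP/negPf ->] //; rewrite eqxx // (negPf sr).
have twu c x : u (s r) c = u r c -> u (tw r (s r) x) c = u x c.
  by rewrite /tw; case: eqVneq => [->|_] //; case: eqVneq => [->|].
apply: conn_trans (IH s' _ _ _) _.
- apply: leq_trans sm; apply: proper_card; apply/properP; split.
    apply/fintype.subsetP => x; rewrite !inE s'E; apply: contra => /eqP sx.
    rewrite tw_out ?sx //; first by apply: contraNneq sr => <-; rewrite sx.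
    by apply: contraNneq sr => xs; apply/eqP/(@perm_inj _ s); rewrite -xs.
  exists (s r); rewrite !inE ?s'E ?twr ?eqxx //.
  by rewrite (inj_eq perm_inj).
- by move=> x; rewrite s'E si twu.
- by move=> x; rewrite s'E sj twu.
case/andP: ijN => ij jN.
apply: conn_trans (@conn_swap N hN n _ r (s r) i j ij jN _ _) _.
- by rewrite !swp_out /inner ?ltnn ?andbF ?si.
- by rewrite !swp_out /inner ?ltnn ?andbF ?sj.
apply: conn_eq => x c _; rewrite /swp.
by have [h|h] := boolP (inner i j c); rewrite ?s'E ?twK.
Qed.

(** The columns beyond [k] form the arc opposite to the one between [0] and [k]: the latter is
    permuted by the inverse of [s], then whole rows by [s]. *)
Lemma conn_glue_outer u (s : {perm 'I_n}) k : k < N ->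
    (forall r, u (s r) 0 = u r 0) -> (forall r, u (s r) k = u r k) ->
  conn u (swp (fun c => k < c) s u).
Proof.
have [->|k0] := posnP k => kN u0 uk.
  apply: conn_trans (conn_perm N _ s) _; apply: conn_eq => r [|c] _.
    by rewrite swp_out.
  by rewrite swp_in.
have sV r c : (forall r, u (s r) c = u r c) -> u (s^-1%g r) c = u r c.
  by move=> h; rewrite -h permKV.
apply: conn_trans (@conn_glue u s^-1%g 0 k _ _ _) _; rewrite ?k0 //.
- by move=> r; apply: sV.
- by move=> r; apply: sV.
apply: conn_trans (conn_perm N _ s) _; apply: conn_eq => r c _.
rewrite /swp /inner; have [->|c0] := posnP c; first by rewrite u0.
by case: ltngtP => //= [_|->]; rewrite ?permK.
Qed.

(** The permutation of rows that a quartic effects on one of its three arcs. *)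
Definition dt (r1 r2 r3 r4 r : 'I_n) := tw r3 r4 (tw r1 r2 r).

Lemma dtE r1 r2 r3 r4 : uniq [:: r1; r2; r3; r4] ->
  [/\ dt r1 r2 r3 r4 r1 = r2, dt r1 r2 r3 r4 r2 = r1,
      dt r1 r2 r3 r4 r3 = r4 & dt r1 r2 r3 r4 r4 = r3].
Proof.
rewrite /= !inE !negb_or => /and4P[/and3P[_ h13 h14] /andP[h23 h24] h34 _].
rewrite /dt twl twr !(@tw_out _ r1 r2) ?twl ?twr 1?eq_sym // 1?eq_sym //.
by rewrite !tw_out.
Qed.

Lemma dt_out r1 r2 r3 r4 r :
  r != r1 -> r != r2 -> r != r3 -> r != r4 -> dt r1 r2 r3 r4 r = r.
Proof. by move=> ? ? ? ?; rewrite /dt !tw_out. Qed.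

Variant row_spec (r1 r2 r3 r4 : 'I_n) : 'I_n -> 'I_n -> Type :=
| Row1 : row_spec r1 r2 r3 r4 r1 r2
| Row2 : row_spec r1 r2 r3 r4 r2 r1
| Row3 : row_spec r1 r2 r3 r4 r3 r4
| Row4 : row_spec r1 r2 r3 r4 r4 r3
| RowOut r of r != r1 & r != r2 & r != r3 & r != r4 : row_spec r1 r2 r3 r4 r r.

Lemma dtP r1 r2 r3 r4 r : uniq [:: r1; r2; r3; r4] ->
  row_spec r1 r2 r3 r4 r (dt r1 r2 r3 r4 r).
Proof.
move=> /dtE[e1 e2 e3 e4].
have [->|n1] := eqVneq r r1; first by rewrite e1; constructor.
have [->|n2] := eqVneq r r2; first by rewrite e2; constructor.
have [->|n3] := eqVneq r r3; first by rewrite e3; constructor.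
have [->|n4] := eqVneq r r4; first by rewrite e4; constructor.
by rewrite dt_out //; constructor.
Qed.

Lemma dtK r1 r2 r3 r4 : uniq [:: r1; r2; r3; r4] -> involutive (dt r1 r2 r3 r4).
Proof.
move=> uq r; have [e1 e2 e3 e4] := dtE uq.
by case: (dtP r uq) => // x *; rewrite dt_out.
Qed.

Lemma twC a b : tw a b =1 (tw b a : 'I_n -> 'I_n).
Proof. by move=> r; rewrite /tw; case: eqVneq => [->|]; case: eqVneq. Qed.

Lemma dtC r1 r2 r3 r4 : dt r2 r1 r4 r3 =1 dt r1 r2 r3 r4.
Proof. by move=> r; rewrite /dt (twC r4) (twC r2). Qed.

(** The easy case of the double exchange: both pairs agree at both ends of the arc, so quadrics
    suffice. *)
Lemma conn_dt u r1 r2 r3 r4 i j : i < j < N ->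
    u r1 i = u r2 i -> u r3 i = u r4 i -> u r1 j = u r2 j -> u r3 j = u r4 j ->
  conn u (swp (inner i j) (dt r1 r2 r3 r4) u).
Proof.
move=> /andP[ij jN] i12 i34 j12 j34.
apply: conn_trans (conn_swap hN ij jN i34 j34) _.
apply: conn_trans (conn_swap hN (a := r1) (b := r2) ij jN _ _) _.
- by rewrite !swp_out // /inner ltnn.
- by rewrite !swp_out // /inner ltnn andbF.
by apply: conn_eq => r c _; rewrite /swp /dt; case: (inner i j c).
Qed.

(** One of the three ways to split four rows into two pairs with opposite entries; the positive
    terms of a quartic show a different one on each arc. *)
Definition pairing u (a b c d : 'I_n) (k : nat) :=
  [&& u a k == u b k, u c k == u d k & u a k != u c k].

(** The blocks of columns are the arcs of the quartic. With primes for complements, the rows [r1] to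
    [r4] read ABC, AB'C', A'BC', A'B'C, and the double exchange on the middle arc produces the
    negative terms. *)
Lemma conn_quartic u r1 r2 r3 r4 j k t : uniq [:: r1; r2; r3; r4] ->
    j.+1 < k -> k < t <= N ->
    (forall c, c <= j -> pairing u r1 r2 r3 r4 c) ->
    (forall c, j < c < k -> pairing u r1 r3 r2 r4 c) ->
    (forall c, k <= c < t -> pairing u r1 r4 r2 r3 c) ->
    (forall c, t <= c < N -> pairing u r1 r2 r3 r4 c) ->
  conn u (swp (inner j k) (dt r1 r2 r3 r4) u).
Proof.
move=> uq jk /andP[kt tN] h1 h2 h3 h1'; have [e1 e2 e3 e4] := dtE uq.
have N0 : 0 < N by apply: leq_trans hN.
have jN : j.+1 < N by apply: leq_trans tN; apply: ltn_trans kt.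
have kN : k < N by apply: leq_trans tN.
(* The first arc wraps around: it starts at column [t], which is column [0] when [t = N]. *)
pose i1 := Ordinal (ltn_pmod t N0); pose S1 := Defs.arc i1 (j.+1 + (N - t)).
pose S2 := Defs.arc (Ordinal jN) (k - j.+1); pose S3 := Defs.arc (Ordinal kN) (t - k).
have in1 (c : 'I_N) : (c \in S1) = (c <= j) || (t <= c).
  rewrite inE cdistE /=; have := ltn_ord c => cN.
  move: tN; rewrite leq_eqVlt => /orP[/eqP tN|tN].
    by rewrite tN modnn leq0n subnn addn0 subn0; lia.
  rewrite modn_small //; clear -cN tN; case: (leqP t c); lia.
have in2 (c : 'I_N) : (c \in S2) = (j < c < k).
  by rewrite inE cdistE /=; have := ltn_ord c => cN; case: (leqP j.+1 c); lia.
have in3 (c : 'I_N) : (c \in S3) = (k <= c < t).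
  by rewrite inE cdistE /=; have := ltn_ord c => cN; case: (leqP k c); lia.
have {h1 h1'} c1 (c : 'I_N) : c \in S1 -> pairing u r1 r2 r3 r4 c.
  by rewrite in1 => /orP[/h1|tc] //; apply: h1'; rewrite tc ltn_ord.
have {h2} c2 (c : 'I_N) : c \in S2 -> pairing u r1 r3 r2 r4 c.
  by rewrite in2 => /h2.
have {h3} c3 (c : 'I_N) : c \in S3 -> pairing u r1 r4 r2 r3 c.
  by rewrite in3 => /h3.
pose w := swp (inner j k) (dt r1 r2 r3 r4) u; rewrite -/w.
have w2 r (c : 'I_N) : c \in S2 -> w r c = u (dt r1 r2 r3 r4 r) c.
  by rewrite in2 => h; rewrite /w swp_in.
have w1 r (c : 'I_N) : c \in S1 -> w r c = u r c.
  by rewrite in1 => h; rewrite /w swp_out // /inner; lia.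
have w3 r (c : 'I_N) : c \in S3 -> w r c = u r c.
  by rewrite in3 => h; rewrite /w swp_out // /inner; lia.
have d12 (c : 'I_N) : c \in S1 -> c \notin S2 by rewrite in1 in2; lia.
have d13 (c : 'I_N) : c \in S1 -> c \notin S3 by rewrite in1 in3; lia.
have d23 (c : 'I_N) : c \in S2 -> c \notin S3 by rewrite in2 in3; lia.
have cov (c : 'I_N) : (c \in S1) || (c \in S2) || (c \in S3).
  by rewrite in1 in2 in3; lia.
have glue (x y z q : nat -> bool) : (forall c : 'I_N, c \in S1 -> x c = q c) ->
    (forall c : 'I_N, c \in S2 -> y c = q c) ->
    (forall c : 'I_N, c \in S3 -> z c = q c) ->
    glue3 (restr S1 (st N x)) (restr S2 (st N y)) (restr S3 (st N z)) = st N q.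
  move=> hx hy hz; apply/ffunP => c; apply: etrans (_ : q c = _); last by rewrite ffunE.
  have [s1|s1] := boolP (c \in S1).
    by apply: etrans (glue3_in1 _ _ _ s1) _; rewrite !ffunE hx.
  have [s2|s2] := boolP (c \in S2).
    by apply: etrans (glue3_in2 _ _ _ s2 s1) _; rewrite !ffunE hy.
  have s3 : c \in S3 by move: (cov c); rewrite (negPf s1) (negPf s2).
  by apply: etrans (glue3_in3 _ _ _ s3 s1 s2) _; rewrite !ffunE hz.
apply: connected_step; right; right; exists S1, S2, S3; split.
  split.
  - by split; [exists i1, (j.+1 + (N - t))|exists (Ordinal jN), (k - j.+1)|
      exists (Ordinal kN), (t - k)].
  - split; apply/set0Pn.
    + by exists (Ordinal N0); rewrite in1.
    + by exists (Ordinal jN); rewrite in2 /=; lia.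
    + by exists (Ordinal kN); rewrite in3 /=; lia.
  - by split; rewrite disjoint_subset; apply/fintype.subsetP => c cS;
      [exact: d12 cS|exact: d13 cS|exact: d23 cS].
  - by apply/setP => c; rewrite finset.in_setT !finset.in_setU cov.
(* The strings are those of [r1]; their complements are read off from [r3] on the first arc and from
   [r2] on the other two. *)
exists (restr S1 (st N (u r1))), (restr S2 (st N (u r1))), (restr S3 (st N (u r1))).
have k1 : compl (restr S1 (st N (u r1))) = restr S1 (st N (u r3)).
  apply/ffunP => c; rewrite !ffunE; have /and3P[_ _] := c1 _ (valP c).
  by case: (u r1 _); case: (u r3 _).
have k2 : compl (restr S2 (st N (u r1))) = restr S2 (st N (u r2)).
  apply/ffunP => c; rewrite !ffunE; have /and3P[_ _] := c2 _ (valP c).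
  by case: (u r1 _); case: (u r2 _).
have k3 : compl (restr S3 (st N (u r1))) = restr S3 (st N (u r2)).
  apply/ffunP => c; rewrite !ffunE; have /and3P[_ _] := c3 _ (valP c).
  by case: (u r1 _); case: (u r2 _).
rewrite /quartic k1 k2 k3.
rewrite (glue _ _ _ (u r1)) //.
rewrite (glue _ _ _ (u r2)) //; last by move=> c /c1/and3P[/eqP].
rewrite (glue _ _ _ (u r3)) //; first last.
- by move=> c /c3/and3P[_ /eqP].
- by move=> c /c2/and3P[/eqP].
rewrite (glue _ _ _ (u r4)) //; first last.
- by move=> c /c3/and3P[/eqP].
- by move=> c /c2/and3P[_ /eqP].
- by move=> c /c1/and3P[_ /eqP].
rewrite (glue _ _ _ (w r2)) //; first last.
- by move=> c cS; rewrite w3.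
- by move=> c cS; rewrite w2 // e2.
- by move=> c cS; rewrite w1 //; have /and3P[/eqP] := c1 c cS.
rewrite (glue _ _ _ (w r1)) //; first last.
- by move=> c cS; rewrite w3.
- by move=> c cS; rewrite w2 // e1.
- by move=> c cS; rewrite w1.
rewrite (glue _ _ _ (w r4)) //; first last.
- by move=> c cS; rewrite w3 //; have /and3P[/eqP] := c3 c cS.
- by move=> c cS; rewrite w2 // e4; have /and3P[/eqP] := c2 c cS.
- by move=> c cS; rewrite w1 //; have /and3P[_ /eqP] := c1 c cS.
rewrite (glue _ _ _ (w r3)) //; first last.
- by move=> c cS; rewrite w3 //; have /and3P[_ /eqP] := c3 c cS.
- by move=> c cS; rewrite w2 // e3; have /and3P[_ /eqP] := c2 c cS.
- by move=> c cS; rewrite w1.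
rewrite table_diff_tab.
move: (uq); rewrite /= !inE !negb_or.
move=> /and4P[/and3P[n12 n13 n14] /andP[n23 n24] n34 _].
rewrite (bigD1 r1) //= (bigD1 r2) 1?eq_sym //= (bigD1 r3) /=; last first.
  by rewrite eq_sym n13 eq_sym n23.
rewrite (bigD1 r4) /=; last by rewrite eq_sym n14 eq_sym n24 eq_sym n34.
rewrite big1 ?addr0; last first.
  move=> r /andP[/andP[/andP[m1 m2] m3] m4].
  rewrite (@st_eq N (w r) (u r)) ?subrr // => c _.
  by rewrite /w /swp dt_out // if_same.
by apply/ffunP => s; rewrite !ffunE; ring.
Qed.

End Flips.

(* lia considers every boolean of the context, which is prohibitively slow when
   entries of tables are around. *)
Ltac idx :=
  repeat match goal with
  | H : ?T |- _ =>
    lazymatch T with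
    | nat => fail
    | is_true (leq _ _) => fail
    | is_true (andb (leq _ _) (leq _ _)) => fail
    | is_true (negb (@eq_op _ ?x _)) =>
      let t := type of x in tryif unify t nat then fail else clear H
    | @eq ?t _ _ => tryif unify t nat then fail else clear H
    | _ => clear H
    end
  end; rewrite ?/inner; lia.

(** * Bringing four rows into the blocks of a quartic *)

Section Flip.

Set Implicit Arguments.
Unset Strict Implicit.
Unset Printing Implicit Defensive.

(** The value [t = m] stands for no failure. *)
Lemma first_failure (p : pred nat) k m : k <= m ->
  exists t, [/\ k <= t <= m, forall c, k <= c < t -> p c & t < m -> ~~ p t].
Proof.
elim: m => [|m IH]; first by rewrite leqn0 => /eqP ->; exists 0; split=> // c; lia.
rewrite leq_eqVlt => /orP[/eqP ->|]; first by exists m.+1; split=> [|c|]; lia.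
rewrite ltnS => /IH[t [/andP[kt tm] ht pt]].
move: tm; rewrite leq_eqVlt => /orP[/eqP tm|tm]; last first.
  by exists t; split=> // [|_]; [lia|apply: pt].
case pm: (p m); last by exists m; split=> [|c|_]; [lia|rewrite -tm; apply: ht|rewrite pm].
exists m.+1; split=> [|c|]; try lia.
rewrite ltnS => /andP[kc]; rewrite leq_eqVlt => /orP[/eqP ->//|cm].
by apply: ht; rewrite kc tm.
Qed.

Variables (N n : nat).
Hypothesis hN : 3 < N.
Implicit Types u v : 'I_n -> nat -> bool.
Local Notation conn := (@conn N n).

(** Symmetries of the pairing; together with [dtC] they let an agreement involving [r2] be treated
    as one involving [r1]. *)
Lemma pairing_sym u a b c d k : pairing u a b c d k = pairing u b a d c k.
Proof.
rewrite /pairing.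
by case: (u a k); case: (u b k); case: (u c k); case: (u d k).
Qed.

Lemma pairing_swap u a b c d k : pairing u a b c d k = pairing u c d a b k.
Proof.
rewrite /pairing.
by case: (u a k); case: (u b k); case: (u c k); case: (u d k).
Qed.

Section FourRows.
Variables r1 r2 r3 r4 : 'I_n.
Hypothesis uq : uniq [:: r1; r2; r3; r4].
Local Notation P12 := (fun u => pairing u r1 r2 r3 r4).
Local Notation P13 := (fun u => pairing u r1 r3 r2 r4).
Local Notation P14 := (fun u => pairing u r1 r4 r2 r3).

Lemma tw_rows : [/\ tw r1 r3 r2 = r2, tw r1 r3 r4 = r4, tw r1 r4 r2 = r2,
  tw r1 r4 r3 = r3 & tw r1 r2 r4 = r4].
Proof.
move: uq; rewrite /= !inE !negb_or.
move=> /and4P[/and3P[n12 n13 n14] /andP[n23 n24] n34 _].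
by split; apply: tw_out; rewrite // eq_sym.
Qed.

(** Exchanging [r1] and [r3] between columns [k - 1] and [s] gives column [k] the pairing of column
    [j]. Both pairs then agree at both ends of the arc, and quadrics suffice. *)
Lemma flip_inner_agree u j k s : j.+1 < k -> k < s < N ->
    P12 u j -> P13 u k.-1 -> P14 u k -> u r1 s = u r3 s ->
  conn u (swp (inner j k) (dt r1 r2 r3 r4) u).
Proof.
move=> jk /andP[ks sN] /and3P[/eqP j12 /eqP j34 _].
move=> /and3P[/eqP k13 /eqP k24 _] /and3P[/eqP k14 /eqP k23 _] s13.
have [e1 e2 e3 e4] := dtE uq.
have inn : (inner k.-1 s k) by idx.
have jout : ~~ inner k.-1 s j by idx.
have k1out : ~~ inner k.-1 s k.-1 by idx.
have Dk1 : inner j k k.-1 by idx.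
have Ds : ~~ inner j k s by idx.
apply: (conn_conj hN (a := r1) (b := r3) (i := k.-1) (j := s)) => //; first by idx.
- by move=> c; idx.
- by rewrite !swp_in // e1 e3.
- by rewrite !swp_out.
have [t132 t134 t142 t143 t124] := tw_rows.
apply: (conn_dt hN); first by idx.
- by rewrite !swp_out.
- by rewrite !swp_out.
- by rewrite !swp_in // twl t132.
- by rewrite !swp_in // twr t134.
Qed.

(** At [s] the rows [r3] and [r4] coincide, both differing from [r1]. Exchanging [r1] and [r4]
    between [k] and [t] makes [r1] agree with [r3] at [s]. *)
Lemma flip_inner_switch u j k s t : j.+1 < k -> k < s < t -> t < N ->
    P12 u j -> P13 u k.-1 -> P14 u k -> u r1 s != u r3 s ->
    u r1 s != u r4 s -> u r1 t = u r4 t ->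
  conn u (swp (inner j k) (dt r1 r2 r3 r4) u).
Proof.
move=> jk /andP[ks st] tN p12 p13 p14 s13 s14 t14.
have [e1 e2 e3 e4] := dtE uq; have [t132 t134 t142 t143 t124] := tw_rows.
have /and3P[/eqP k14 _ _] := p14.
apply: (conn_conj hN (a := r1) (b := r4) (i := k) (j := t)) => //; first by idx.
- by move=> c; idx.
- by rewrite !swp_out //; idx.
- by rewrite !swp_out //; idx.
have le c : c <= k -> forall r, swp (inner k t) (tw r1 r4) u r c = u r c.
  by move=> ck r; rewrite swp_out //; idx.
apply: (@flip_inner_agree _ j k s) => //.
- by idx.
- by rewrite /pairing !le //; idx.
- by rewrite /pairing !le //; idx.
- by rewrite /pairing !le.
rewrite !swp_in /inner ?ks // twl t143.
by case: (u r1 s) s13 s14; case: (u r3 s); case: (u r4 s).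
Qed.

End FourRows.

(** Without an agreement that lets quadrics suffice, every column beyond [k] pairs [r1] with [r4] or
    with [r2]. If the first kind precedes the second, the four rows form the blocks of a quartic. *)
Lemma flip_inner r1 r2 r3 r4 u j k : uniq [:: r1; r2; r3; r4] ->
    j.+1 < k -> k < N ->
    (forall c, c <= j -> pairing u r1 r2 r3 r4 c) ->
    (forall c, j < c < k -> pairing u r1 r3 r2 r4 c) ->
    pairing u r1 r4 r2 r3 k ->
  conn u (swp (inner j k) (dt r1 r2 r3 r4) u).
Proof.
move=> uq jk kN h12 h13 p14.
have p12 : pairing u r1 r2 r3 r4 j by apply: h12.
have p13 : pairing u r1 r3 r2 r4 k.-1 by apply: h13; idx.
have uq' : uniq [:: r2; r1; r4; r3].
  move: uq; rewrite /= !inE !negb_or.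
  move=> /and4P[/and3P[n12 n13 n14] /andP[n23 n24] n34 _].
  by rewrite eq_sym n12 n24 n23 n14 n13 eq_sym n34.
have [[s [sN s13]]|/forallNP no13] := pselect (exists s, k < s < N /\ u r1 s = u r3 s).
  exact: flip_inner_agree s13.
have [[s [sN s24]]|/forallNP no24] := pselect (exists s, k < s < N /\ u r2 s = u r4 s).
  apply: (conn_ext (dtC _ _ _ _)); apply: flip_inner_agree s24 => //.
  - by rewrite pairing_sym.
  - by rewrite pairing_swap.
  - by rewrite pairing_swap.
have {no13} no13 s : k < s < N -> u r1 s != u r3 s.
  by move=> h; apply/eqP => e; apply: (no13 s).
have {no24} no24 s : k < s < N -> u r2 s != u r4 s.
  by move=> h; apply/eqP => e; apply: (no24 s).
have [t [/andP[kt tN] tp tf]] := @first_failure (fun c => u r1 c == u r4 c) k.+1 N kN.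
(* A return to agreement of [r1] and [r4] after their first difference at [t] is the switching case,
   with [t] and [s] in the roles of its [s] and [t]. *)
have [[s [sN s14]]|/forallNP no14] := pselect (exists s, t < s < N /\ u r1 s = u r4 s).
  have tN' : t < N by idx.
  apply: (@flip_inner_switch _ _ _ _ uq u j k t s) => //; try idx.
  - by apply: no13; idx.
  - exact: tf.
have fits c : k < c < N -> (u r1 c == u r4 c) = (c < t).
  move=> hc; have [ct|tc|ct] := ltngtP c t; first by apply: tp; idx.
    by apply/eqP => e; apply: (no14 c); split=> //; idx.
  by apply: negbTE; rewrite ct; apply: tf; idx.
apply: (@conn_quartic _ _ hN u r1 r2 r3 r4 j k t) => //; try idx.
- move=> c hc; have [->//|ck] := eqVneq c k.
  have h : k < c < N by idx.
  have := fits c h; rewrite (_ : c < t); last by idx.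
  have := no13 c h; have := no24 c h; rewrite /pairing.
  by case: (u r1 c); case: (u r2 c); case: (u r3 c); case: (u r4 c).
- move=> c hc; have h : k < c < N by idx.
  have := fits c h; rewrite (_ : (c < t) = false); last by idx.
  have := no13 c h; have := no24 c h; rewrite /pairing.
  by case: (u r1 c); case: (u r2 c); case: (u r3 c); case: (u r4 c).
Qed.

Section FourRows2.
Variables r1 r2 r3 r4 : 'I_n.
Hypothesis uq : uniq [:: r1; r2; r3; r4].

(** Exchanging [r1] and [r4] between [s] and [k] gives column [k - 1] the pairing of column [0], so
    quadrics suffice on the arc between these two columns. *)
Lemma flip_outer_agree u k s : 0 < s < k.-1 -> k < N ->
    pairing u r1 r2 r3 r4 0 -> pairing u r1 r3 r2 r4 k.-1 ->
    pairing u r1 r4 r2 r3 k -> u r1 s = u r4 s ->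
  conn u (swp (fun c => k <= c) (dt r1 r2 r3 r4) u).
Proof.
move=> sk kN /and3P[/eqP z12 /eqP z34 _].
move=> /and3P[/eqP k13 /eqP k24 _] /and3P[/eqP k14 /eqP k23 _] s14.
have [e1 e2 e3 e4] := dtE uq; have [t132 t134 t142 t143 t124] := tw_rows uq.
apply: (conn_conj hN (a := r1) (b := r4) (i := s) (j := k)) => //; first by idx.
- by move=> c; idx.
- by rewrite !swp_out //; idx.
- by rewrite !swp_in // e1 e4.
have inn : inner s k k.-1 by idx.
set v := swp (inner s k) (tw r1 r4) u.
have v12 : v r1 0 = v r2 0 by rewrite /v !swp_out //; idx.
have v34 : v r3 0 = v r4 0 by rewrite /v !swp_out //; idx.
have w12 : v r1 k.-1 = v r2 k.-1.
  by rewrite /v !swp_in // twl t142.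
have w34 : v r3 k.-1 = v r4 k.-1.
  by rewrite /v !swp_in // twr t143.
(* Columns [0] and [k - 1] are now invariant under the double exchange, so the arc between them may
   stand for the columns from [k] on. *)
apply: (@conn_compl _ _ (inner 0 k.-1)); first exact: dtK.
  move=> r c cN; rewrite /inner => h.
  have [->|->] : c = 0 \/ c = k.-1 by move: h; idx.
    by case: (dtP r uq).
  by case: (dtP r uq).
by apply: conn_dt => //; idx.
Qed.

(** At [s] the rows [r2] and [r4] coincide, both differing from [r1]. Exchanging [r1] and [r2]
    between [0] and [t] makes [r1] agree with [r4] at [s]. *)
Lemma flip_outer_switch u k s t : 0 < s < t -> t < k.-1 -> k < N ->
    pairing u r1 r2 r3 r4 0 -> pairing u r1 r3 r2 r4 k.-1 ->
    pairing u r1 r4 r2 r3 k -> u r1 s != u r4 s ->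
    u r1 s != u r2 s -> u r1 t = u r2 t ->
  conn u (swp (fun c => k <= c) (dt r1 r2 r3 r4) u).
Proof.
move=> st tk kN p12 p13 p14 s14 s12 t12.
have [t132 t134 t142 t143 t124] := tw_rows uq.
have /and3P[/eqP z12 _ _] := p12.
apply: (conn_conj hN (a := r1) (b := r2) (i := 0) (j := t)) => //; first by idx.
- by move=> c; idx.
- by rewrite !swp_out //; idx.
- by rewrite !swp_out //; idx.
have out c : c = 0 \/ t <= c -> forall r, swp (inner 0 t) (tw r1 r2) u r c = u r c.
  by move=> h r; rewrite swp_out //; move: h; idx.
have o1 := out k.-1 (or_intror (ltnW tk)).
have tk' : t <= k by idx.
have o2 := out k (or_intror tk').
apply: (@flip_outer_agree _ k s) => //.
- by idx.
- by rewrite /pairing !o1.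
- by rewrite /pairing !o2.
rewrite swp_in /inner ?st // swp_in /inner ?st // twl t124.
by case: (u r1 s) s12 s14; case: (u r2 s); case: (u r4 s).
Qed.

End FourRows2.

(** Agreements are now sought strictly between [0] and [k - 1]. If none helps, these columns pair
    [r1] with [r2] before [t] and with [r3] from [t] on, which are the blocks that [flip_inner] asks
    for. *)
Lemma flip_outer r1 r2 r3 r4 u k : uniq [:: r1; r2; r3; r4] -> 1 < k < N ->
    pairing u r1 r2 r3 r4 0 -> pairing u r1 r3 r2 r4 k.-1 ->
    pairing u r1 r4 r2 r3 k ->
  conn u (swp (fun c => k <= c) (dt r1 r2 r3 r4) u).
Proof.
move=> uq /andP[k1 kN] p12 p13 p14.
have uq' : uniq [:: r2; r1; r4; r3].
  move: uq; rewrite /= !inE !negb_or.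
  move=> /and4P[/and3P[n12 n13 n14] /andP[n23 n24] n34 _].
  by rewrite eq_sym n12 n24 n23 n14 n13 eq_sym n34.
have [[s [sN s14]]|/forallNP no14] := pselect (exists s, 0 < s < k.-1 /\ u r1 s = u r4 s).
  exact: flip_outer_agree s14.
have [[s [sN s23]]|/forallNP no23] := pselect (exists s, 0 < s < k.-1 /\ u r2 s = u r3 s).
  apply: (conn_ext (dtC _ _ _ _)); apply: flip_outer_agree s23 => //.
  - by rewrite pairing_sym.
  - by rewrite pairing_swap.
  - by rewrite pairing_swap.
have {no14} no14 s : 0 < s < k.-1 -> u r1 s != u r4 s.
  by move=> h; apply/eqP => e; apply: (no14 s).
have {no23} no23 s : 0 < s < k.-1 -> u r2 s != u r3 s.
  by move=> h; apply/eqP => e; apply: (no23 s).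
have k0 : 1 <= k.-1 by idx.
have [t [/andP[t0 tk] tp tf]] := @first_failure (fun c => u r1 c == u r2 c) 1 k.-1 k0.
have [[s [sN s12]]|/forallNP no12] := pselect (exists s, t < s < k.-1 /\ u r1 s = u r2 s).
  have tk' : t < k.-1 by idx.
  apply: (@flip_outer_switch _ _ _ _ uq u k t s) => //; try idx.
  - by apply: no14; idx.
  - exact: tf.
have fits c : 0 < c < k.-1 -> (u r1 c == u r2 c) = (c < t).
  move=> hc; have [ct|tc|ct] := ltngtP c t; first by apply: tp; idx.
    by apply/eqP => e; apply: (no12 c); split=> //; idx.
  by apply: negbTE; rewrite ct; apply: tf; idx.
have low c : c <= t.-1 -> pairing u r1 r2 r3 r4 c.
  move=> ct; have [->//|c0] := posnP c; have h : 0 < c < k.-1 by idx.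
  have := fits c h; rewrite (_ : c < t); last by idx.
  have := no14 c h; have := no23 c h; rewrite /pairing.
  by case: (u r1 c); case: (u r2 c); case: (u r3 c); case: (u r4 c).
have [e1 e2 e3 e4] := dtE uq.
(* Columns up to [t - 1] are invariant under the double exchange, so the columns from [k] on may be
   replaced by those from [t] to [k - 1]. *)
apply: (@conn_compl _ _ (inner t.-1 k)); first exact: dtK.
  move=> r c cN; rewrite /inner => h.
  have /low/and3P[/eqP c12 /eqP c34 _] : c <= t.-1 by move: h; idx.
  by case: (dtP r uq).
apply: flip_inner => //; first by idx.
move=> c hc; have [->//|ck] := eqVneq c k.-1; have h : 0 < c < k.-1 by idx.
have := fits c h; rewrite (_ : (c < t) = false); last by idx.
have := no14 c h; have := no23 c h; rewrite /pairing.
by case: (u r1 c); case: (u r2 c); case: (u r3 c); case: (u r4 c).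
Qed.

End Flip.

(** * Counts of rows fixed by the edge margins *)

Section Counts.

Set Implicit Arguments.
Unset Strict Implicit.
Unset Printing Implicit Defensive.
Import GRing.Theory.

Lemma connected_same_marginals (V : finType) (e : rel V) (B : set (move V))
    (u v : table V) : (forall m, B m -> in_kernel e m) ->
  connected_by B u v -> same_marginals e u v.
Proof.
move=> Bk [m [w [<- <- hw]]] W cW y.
elim: m hw => // m IH hw; rewrite IH => [|k km]; last by apply: hw; apply: ltnW.
have : (marginal (table_diff (w m.+1) (w m)) y = 0)%R.
  have [/Bk->//|/Bk/(_ W cW y)] := hw m (ltnSn m).
  by rewrite marginalN => /eqP; rewrite oppr_eq0 => /eqP.
by rewrite marginal_table_diff => /eqP; rewrite subr_eq0 => /eqP[].
Qed.

Lemma sum_bool_gt0 (I : finType) (P : I -> bool) :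
  0 < \sum_i P i -> exists i, P i.
Proof.
move=> h; have [i Pi|P0] := pickP P; first by exists i.
by rewrite big1 // in h => i _; rewrite P0.
Qed.

Lemma perm_of_counts (T : finType) n (f g : 'I_n -> T) :
    (forall t, \sum_r (f r == t) = \sum_r (g r == t)) ->
  exists s : {perm 'I_n}, forall r, f r = g (s r).
Proof.
move=> h; have cE (F : 'I_n -> T) t : count_mem t [tuple F r | r < n] = \sum_r (F r == t).
  by rewrite -sum1_count big_map big_enum_cond /= big_mkcond.
have /tuple_permP[s sE] : perm_eq [tuple f r | r < n] [tuple g r | r < n].
  by apply/allP => t _ /=; rewrite !cE h.
exists s => r; have := congr1 (fun l => nth (f r) l r) sE.
by rewrite -!tnth_nth !tnth_mktuple.
Qed.

Lemma table_rows (T : finType) (U : T -> nat) :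
  exists l : seq T, forall s, count_mem s l = U s.
Proof.
exists (flatten [seq nseq (U x) x | x <- enum T]) => s.
rewrite count_flatten -map_comp sumnE big_map big_enum (bigD1 s) //=.
rewrite count_nseq /= eqxx mul1n big1 ?addn0 // => x /negPf xs.
by rewrite count_nseq /= xs.
Qed.

Lemma xor_le_changes (z : nat -> bool) m :
  z 0 (+) z m <= \sum_(i < m) (z i (+) z i.+1).
Proof.
elim: m => [|m IH]; first by rewrite big_ord0 addbb.
rewrite big_ord_recr /=; apply: leq_trans (leq_add IH (leqnn _)).
by case: (z 0); case: (z m); case: (z m.+1).
Qed.

(** A word that never returns to its initial value after leaving it changes at most once. *)
Lemma xor_eq_changes (z : nat -> bool) m :
    (forall s t, s < t <= m -> z s != z 0 -> z t = z 0 -> False) ->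
  \sum_(i < m) (z i (+) z i.+1) = (z 0 (+) z m) :> nat.
Proof.
elim: m => [|m IH] h; first by rewrite big_ord0 addbb.
rewrite big_ord_recr /= IH; last first.
  by move=> s t /andP[st tm]; apply: h; rewrite st ltnW.
have := h m m.+1; rewrite !ltnS leqnn => /(_ isT).
by case: (z 0); case: (z m); case: (z m.+1) => //= /(_ isT erefl).
Qed.

Variables (N n : nat).
Hypothesis hN : 3 < N.
Implicit Types u v : 'I_n -> nat -> bool.
Local Notation conn := (@conn N n).

Definition same u v := same_marginals (cycle_adj N) (tab N u) (tab N v).

Lemma conn_same u v : conn u v -> same u v.
Proof.
by apply: connected_same_marginals => m [/(B2_kernel hN)|/(B4_kernel hN)].
Qed.

Definition cnt u (p : (nat -> bool) -> bool) : nat := \sum_(r < n) p (u r).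

Lemma cnt_gt0 u p : 0 < cnt u p -> exists r, p (u r).
Proof. exact: sum_bool_gt0. Qed.

Lemma marginal_tab u (W : {set 'I_N}) (y : partial_state W) :
  marginal (tab N u) y = \sum_(r < n) (restr W (st N (u r)) == y).
Proof.
rewrite /marginal.
under eq_bigr => x _ do rewrite ffunE.
rewrite exchange_big; apply: eq_bigr => r _ /=.
rewrite big_mkcond (bigD1 (st N (u r))) //= eqxx big1 ?addn0.
  by case: (restr _ _ == y).
by move=> x /negPf xu; rewrite [st _ _ == x]eq_sym xu if_same.
Qed.

(** Any function of the two entries is a sum of indicators of value pairs, and these are counted by
    the marginal of the edge. *)
Lemma same_cnt_edge u v (c d : 'I_N) (f : bool -> bool -> bool) : same u v ->
    c != d -> cycle_adj N c d ->
  cnt u (fun x => f (x c) (x d)) = cnt v (fun x => f (x c) (x d)).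
Proof.
move=> uv cd acd.
have eq1 a b : cnt u (fun x => (x c == a) && (x d == b))
             = cnt v (fun x => (x c == a) && (x d == b)).
  have cW : clique (cycle_adj N) (c |: [set d])%SET.
    move=> i j; rewrite !inE => /orP[]/eqP-> /orP[]/eqP->; rewrite ?eqxx //.
    by move: acd; rewrite /cycle_adj orbC.
  have := uv _ cW (restr _ (st N (fun k => if k == c then a else b))).
  rewrite !marginal_tab.
  have e x : (restr (c |: [set d])%SET (st N x) ==
     restr _ (st N (fun k => if k == c then a else b))) = (x c == a) && (x d == b).
    apply/eqP/andP => [/restr_inj e|[/eqP xc /eqP xd]].
      have := (e c, e d); rewrite !inE !eqxx orbT !ffunE eqxx => -[/(_ isT)-> /(_ isT)->].
      by rewrite ifF // val_eqE eq_sym (negPf cd).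
    apply: restr_eq => k; rewrite !inE => /orP[]/eqP->; rewrite !ffunE ?eqxx //.
    by rewrite ifF // val_eqE eq_sym (negPf cd).
  by under eq_bigr => r _ do rewrite e; under [in RHS]eq_bigr => r _ do rewrite e.
have dec w : cnt w (fun x => f (x c) (x d)) =
    \sum_a \sum_b f a b * cnt w (fun x => (x c == a) && (x d == b)).
  rewrite /cnt (eq_bigr (fun r => \sum_a \sum_b
      f a b * ((w r c == a) && (w r d == b)))).
    rewrite exchange_big; apply: eq_bigr => a _.
    by rewrite exchange_big; apply: eq_bigr => b _; rewrite big_distrr.
  move=> r _; rewrite !big_bool /=.
  by case: (w r c); case: (w r d); case: (f _ _); rewrite ?muln0 ?muln1 ?mul0n.
rewrite !dec; apply: eq_bigr => a _; apply: eq_bigr => b _.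
by rewrite eq1.
Qed.

Lemma same_cnt_step u v c (f : bool -> bool -> bool) : same u v -> c.+1 < N ->
  cnt u (fun x => f (x c) (x c.+1)) = cnt v (fun x => f (x c) (x c.+1)).
Proof.
move=> uv cN.
apply: (@same_cnt_edge u v (Ordinal (ltnW cN)) (Ordinal cN)) => //.
  by rewrite -val_eqE /= neq_ltn ltnSn.
by rewrite cycle_adjE ?eqxx //; apply: ltn_trans hN.
Qed.

(** The closing edge of the cycle. *)
Lemma same_cnt_last u v (f : bool -> bool -> bool) : same u v ->
  cnt u (fun x => f (x 0) (x N.-1)) = cnt v (fun x => f (x 0) (x N.-1)).
Proof.
move=> uv; have N0 : 0 < N by apply: leq_trans hN.
have N1 : N.-1 < N by rewrite prednK.
apply: (@same_cnt_edge u v (Ordinal N0) (Ordinal N1)) => //.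
  by rewrite -val_eqE /=; lia.
by rewrite cycle_adjE /=; lia.
Qed.

(** Stated additively, to avoid truncated subtraction. *)
Lemma cnt_change2 u v p a b : a != b ->
    (forall r, r != a -> r != b -> p (v r) = p (u r)) ->
  cnt v p + p (u a) + p (u b) = cnt u p + p (v a) + p (v b).
Proof.
move=> ab h; rewrite /cnt !(bigD1 a (P := xpredT)) //=.
rewrite !(bigD1 b (P := fun i => i != a)) 1?eq_sym //=.
rewrite (eq_bigr (fun r => nat_of_bool (p (u r)))); last first.
  by move=> r /andP[ra rb]; rewrite h.
by ring.
Qed.

End Counts.

(** * Lowering the two free parameters of a triple margin *)

Section Descent.

Set Implicit Arguments.
Unset Strict Implicit.
Unset Printing Implicit Defensive.

Variables (N n : nat).
Hypothesis hN : 3 < N.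
Implicit Types u v : 'I_n -> nat -> bool.
Local Notation conn := (@conn N n).
Local Notation same := (@same N n).

(** Columns [1] to [m] are the ones still to be matched. *)
Definition eq_off m u v :=
  forall r c, c < N -> ~~ (0 < c <= m) -> u r c = v r c.

Lemma eq_off_sym m u v : eq_off m u v -> eq_off m v u.
Proof. by move=> h r c cN hc; rewrite h. Qed.

Lemma eq_off_trans m u v w : eq_off m u v -> eq_off m v w -> eq_off m u w.
Proof. by move=> h1 h2 r c cN hc; rewrite h1 ?h2. Qed.

(** These two counts parametrise the margins on columns [0], [m], [m + 1] once those on [{0, m + 1}]
    and [{m, m + 1}] are fixed. *)
Definition cnt2 m u := cnt u (fun x => x 0 && x m).
Definition cnt3 m u := cnt u (fun x => [&& x 0, x m & x m.+1]).

Lemma cnt_off u v m (p : (nat -> bool) -> bool) : eq_off m u v -> m.+1 < N ->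
    (forall x y : nat -> bool, x 0 = y 0 -> x m.+1 = y m.+1 -> p x = p y) ->
  cnt u p = cnt v p.
Proof.
move=> uv mN hp; apply: eq_bigr => r _; congr nat_of_bool.
by apply: hp; apply: uv => //; rewrite ?ltnn ?andbF //; apply: leq_ltn_trans mN.
Qed.

(** Exchanging columns [s + 1] to [m] turns the entries 11 and 00 of [X] and [Y] at columns [0] and
    [m] into 10 and 01. *)
Lemma pair_swap_step u m X Y s : 0 < s < m -> m.+1 < N ->
    u X s = u Y s -> u X 0 -> u X m -> ~~ u Y 0 -> ~~ u Y m ->
    u X m.+1 = u Y m.+1 ->
  exists u', [/\ conn u u', eq_off m u' u & (cnt2 m u').+1 = cnt2 m u].
Proof.
move=> /andP[s0 sm] mN sXY X0 Xm Y0 Ym kXY.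
have XY : X != Y by apply: contraTneq X0 => ->.
exists (swp (inner s m.+1) (tw X Y) u); split.
- by apply: (conn_swap hN) => //; apply: ltnW.
- by move=> r c cN hc; rewrite swp_out // /inner; move: hc; idx.
have o r : swp (inner s m.+1) (tw X Y) u r 0 = u r 0 by rewrite swp_out.
have i r : swp (inner s m.+1) (tw X Y) u r m = u (tw X Y r) m.
  by rewrite swp_in // /inner sm ltnSn.
have := @cnt_change2 n u (swp (inner s m.+1) (tw X Y) u) (fun x => x 0 && x m) X Y XY.
rewrite /= !o !i twl twr X0 Xm (negPf Y0) (negPf Ym) /= !addn0 addn1; apply.
by move=> r rX rY; rewrite o i tw_out.
Qed.

(** A change between consecutive columns, even relative to the fixed row [X], is a condition on the
    entries of one edge. *)
Lemma same_changes u v (X : nat -> bool) m : same u v -> m < N ->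
  \sum_r \sum_(i < m) ((u r i (+) X i) (+) (u r i.+1 (+) X i.+1)) =
  \sum_r \sum_(i < m) ((v r i (+) X i) (+) (v r i.+1 (+) X i.+1)) :> nat.
Proof.
move=> uv mN; rewrite exchange_big [in RHS]exchange_big; apply: eq_bigr => i _.
apply: (same_cnt_step hN (fun a b => (a (+) X i) (+) (b (+) X i.+1)) uv).
exact: leq_ltn_trans (ltn_ord i) mN.
Qed.

Lemma cnt_split u (p q : (nat -> bool) -> bool) :
  cnt u p = cnt u (fun x => p x && q x) + cnt u (fun x => p x && ~~ q x).
Proof.
by rewrite /cnt -big_split; apply: eq_bigr => r _ /=; case: (p _); case: (q _).
Qed.

(* If no row had two sign changes relative to the constant pair X, Y, then the
   parity of the changes would determine their number; but the total number of
   changes is a function of the edge marginals. *)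
Lemma exists_two_changes u v (X : nat -> bool) m : same u v -> eq_off m u v ->
    0 < m -> m.+1 < N -> X 0 -> X m -> cnt2 m v < cnt2 m u ->
  exists r s t, [/\ s < t <= m, u r s (+) X s != u r 0 (+) X 0 &
                    u r t (+) X t = u r 0 (+) X 0].
Proof.
move=> uv off m0 mN X0 Xm Quv; apply: contrapT => h.
(* Since the counts at [0] and at [m] agree, a larger [cnt2] means fewer rows with different entries
   at [0] and [m]. *)
have qE (w : 'I_n -> nat -> bool) : cnt w (fun x => x 0 (+) x m) + 2 * cnt2 m w =
    cnt w (fun x => x 0) + cnt w (fun x => x m).
  rewrite /cnt2 /cnt big_distrr /= -!big_split; apply: eq_bigr => r _ /=.
  by case: (w r 0); case: (w r m).
have c0 : cnt u (fun x => x 0) = cnt v (fun x => x 0).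
  by apply: cnt_off off mN _ => x y ->.
have cm : cnt u (fun x => x m) = cnt v (fun x => x m).
  exact: (same_cnt_step hN (fun a _ => a) uv mN).
have xE (w : 'I_n -> nat -> bool) :
    \sum_r ((w r 0 (+) X 0) (+) (w r m (+) X m)) = cnt w (fun x => x 0 (+) x m).
  by apply: eq_bigr => r _; rewrite X0 Xm; case: (w r 0); case: (w r m).
have lev : cnt v (fun x => x 0 (+) x m) <= cnt u (fun x => x 0 (+) x m).
  rewrite -!xE; have := same_changes X uv (ltnW mN).
  rewrite [LHS](eq_bigr (fun r => nat_of_bool ((u r 0 (+) X 0) (+) (u r m (+) X m)))).
    by move=> ->; apply: leq_sum => r _; apply: (@xor_le_changes (fun i => v r i (+) X i)).
  move=> r _; apply: (@xor_eq_changes (fun i => u r i (+) X i)) => s t st hs ht.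
  by apply: h; exists r, s, t.
by have := qE u; have := qE v; rewrite c0 cm; move: lev Quv; clear; lia.
Qed.

(** Rows [X] and [Y] with entries 11 and 00 at columns [0] and [m], equal at [m + 1], are exchanged
    from an inner column where they agree. If there is none, a third row [Z] is used to create
    one. *)
Lemma cnt2_step u v m : same u v -> eq_off m u v -> 0 < m -> m.+1 < N ->
    cnt2 m v < cnt2 m u ->
  exists u', [/\ conn u u', eq_off m u' u & (cnt2 m u').+1 = cnt2 m u].
Proof.
move=> uv off m0 mN Quv.
pose T (b : bool) (w : 'I_n -> nat -> bool) :=
  cnt w (fun x => (x 0 && x m) && (x m.+1 == b)).
have [b Tb] : exists b, T b v < T b u.
  have e (w : 'I_n -> nat -> bool) : cnt2 m w = T true w + T false w.
    rewrite /cnt2 (cnt_split w _ (fun x => x m.+1 == true)); congr (_ + _).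
    by apply: eq_bigr => r _; case: (w r m.+1).
  by move: Quv; rewrite !e => h; have [h'|h'] := ltnP (T true v) (T true u);
    [exists true|exists false; move: h h'; clear; lia].
have /cnt_gt0[X /andP[/andP[X0 Xm] /eqP Xk]] : 0 < T b u by apply: leq_ltn_trans Tb.
(* By inclusion-exclusion, the rows 00 with entry [b] at [m + 1] have the same excess over [v] as
   the rows 11, since all other counts involved agree. *)
have [Y [Y0 Ym Yk]] : exists Y, [/\ ~~ u Y 0, ~~ u Y m & u Y m.+1 = b].
  pose S (w : 'I_n -> nat -> bool) :=
    cnt w (fun x => (~~ x 0 && ~~ x m) && (x m.+1 == b)).
  suff /cnt_gt0[Y /andP[/andP[Y0 Ym] /eqP Yk]] : 0 < S u by exists Y.
  have e (w : 'I_n -> nat -> bool) :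
    S w + cnt w (fun x => x 0 && (x m.+1 == b)) +
      cnt w (fun x => x m && (x m.+1 == b)) = cnt w (fun x => x m.+1 == b) + T b w.
    rewrite /S /T /cnt -!big_split; apply: eq_bigr => r _ /=.
    by case: (w r 0); case: (w r m); case: (_ == b).
  have := e u; have := e v.
  rewrite (cnt_off (p := fun x => x 0 && (x m.+1 == b)) off mN); last by move=> x y -> ->.
  rewrite (cnt_off (p := fun x => x m.+1 == b) off mN); last by move=> x y _ ->.
  rewrite (same_cnt_step hN (fun a c => a && (c == b)) uv mN).
  by move: Tb; clear; lia.
have kXY : u X m.+1 = u Y m.+1 by rewrite Xk Yk.
have [[s [sm sXY]]|/forallNP noXY] := pselect (exists s, 0 < s < m /\ u X s = u Y s).
  exact: pair_swap_step sXY X0 Xm Y0 Ym kXY.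
have cXY s : s <= m -> u Y s = ~~ u X s.
  move=> sm; have [->|s0] := posnP s; first by rewrite X0 (negPf Y0).
  have [->|sm'] := eqVneq s m; first by rewrite Xm (negPf Ym).
  have h : 0 < s < m by rewrite s0 ltn_neqAle sm' sm.
  have : u X s <> u Y s by move=> e; apply: (noXY s).
  by case: (u X s); case: (u Y s).
have [Z [s [t [/andP[st tm] zs zt]]]] := exists_two_changes uv off m0 mN X0 Xm Quv.
have s0 : 0 < s by case: s zs {st} => //; rewrite eqxx.
have t0 : 0 < t by apply: ltn_trans st.
have tN : t < N by apply: leq_ltn_trans tm (ltnW mN).
have XY : X != Y by apply: contraTneq X0 => ->.
(* Once [X] and [Y] agree at [s], with columns [0], [m] and [m + 1] unchanged, the previous case
   applies. *)
have fin u1 : conn u u1 -> eq_off m u1 u -> (forall r, u1 r m = u r m) ->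
    u1 X s = u1 Y s ->
  exists u', [/\ conn u u', eq_off m u' u & (cnt2 m u').+1 = cnt2 m u].
  move=> c1 off1 e1 es.
  have z1 r : u1 r 0 = u r 0 by apply: off1 => //; apply: leq_ltn_trans mN.
  have k1 r : u1 r m.+1 = u r m.+1 by apply: off1; rewrite // ltnn andbF.
  have sm : 0 < s < m by rewrite s0 (leq_trans st tm).
  have [|||||u' [c2 off2 Q2]] := pair_swap_step sm mN es _ _ _ _ _; rewrite ?z1 ?e1 ?k1 //.
  exists u'; split; first exact: conn_trans c2.
    exact: eq_off_trans off2 off1.
  by rewrite Q2 /cnt2; apply: eq_bigr => r _; rewrite z1 e1.
have sw P : u P 0 = u Z 0 -> u P t = u Z t ->
    (swp (inner 0 t) (tw P Z) u X s = swp (inner 0 t) (tw P Z) u Y s) ->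
  exists u', [/\ conn u u', eq_off m u' u & (cnt2 m u').+1 = cnt2 m u].
  move=> P0 Pt; apply: fin.
  - exact: (conn_swap hN).
  - by move=> r c cN hc; rewrite swp_out //; move: hc; idx.
  - by move=> r; rewrite swp_out //; idx.
have ins : inner 0 t s by rewrite /inner s0.
have sm' : s <= m by apply: leq_trans tm; apply: ltnW.
(* The row [Z] starts like [X] or like [Y]. It is exchanged with that row, which it meets again at
   [t] and differs from at [s]; as [X] and [Y] are complementary there, they come to agree at
   [s]. *)
move: zs zt; rewrite X0; case Z0: (u Z 0) => /= zs zt.
  apply: (sw X); rewrite ?X0 ?Z0 //; first by move: zt; case: (u Z t); case: (u X t).
  have YZ : Y != Z by apply: contraNneq Y0 => ->; rewrite Z0.
  rewrite !swp_in // twl tw_out 1?eq_sym // 1?eq_sym // cXY //.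
  by move: zs; case: (u Z s); case: (u X s).
apply: (sw Y); rewrite ?Z0 ?(negPf Y0) //.
  by rewrite cXY //; move: zt; case: (u Z t); case: (u X t).
have XZ : X != Z by apply: contraTneq X0 => ->; rewrite Z0.
rewrite !swp_in // twl tw_out //.
by move: zs; case: (u Z s); case: (u X s).
Qed.

(** As the pair margins agree, the triple margins differ by a multiple of the parity sign, so all
    four triples with an odd number of ones are more frequent in [u]. The double exchange makes four
    such rows even. *)
Lemma cnt3_step u v m : same u v -> eq_off m u v -> 0 < m -> m.+1 < N ->
    cnt2 m v = cnt2 m u -> cnt3 m v < cnt3 m u ->
  exists u', [/\ conn u u', eq_off m u' u, cnt2 m u' = cnt2 m u &
                 (cnt3 m u').+1 = cnt3 m u].
Proof.
move=> uv off m0 mN Quv Ruv.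
have [r1 /and3P[a1 b1 c1]] : exists r, [&& u r 0, u r m & u r m.+1].
  by apply: (@cnt_gt0 _ u (fun x => [&& x 0, x m & x m.+1])); apply: leq_ltn_trans Ruv.
have c0 : cnt u (fun x => x 0) = cnt v (fun x => x 0).
  by apply: cnt_off off mN _ => x y ->.
have cm : cnt u (fun x => x m) = cnt v (fun x => x m).
  exact: (same_cnt_step hN (fun a _ => a) uv mN).
have ck : cnt u (fun x => x m.+1) = cnt v (fun x => x m.+1).
  by apply: cnt_off off mN _ => x y _ ->.
have c0k : cnt u (fun x => x 0 && x m.+1) = cnt v (fun x => x 0 && x m.+1).
  by apply: cnt_off off mN _ => x y -> ->.
have cmk : cnt u (fun x => x m && x m.+1) = cnt v (fun x => x m && x m.+1).
  exact: (same_cnt_step hN andb uv mN).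
have [r2 /and3P[a2 b2 c2]] : exists r, [&& u r 0, ~~ u r m & ~~ u r m.+1].
  pose S (w : 'I_n -> nat -> bool) := cnt w (fun x => [&& x 0, ~~ x m & ~~ x m.+1]).
  apply: (@cnt_gt0 _ u (fun x => [&& x 0, ~~ x m & ~~ x m.+1])).
  have e (w : 'I_n -> nat -> bool) :
    S w + cnt2 m w + cnt w (fun x => x 0 && x m.+1) = cnt w (fun x => x 0) + cnt3 m w.
    rewrite /S /cnt2 /cnt3 /cnt -!big_split; apply: eq_bigr => r _ /=.
    by case: (w r 0); case: (w r m); case: (w r m.+1).
  by rewrite -/(S u); have := e u; have := e v; rewrite c0 c0k Quv; move: Ruv; clear; lia.
have [r3 /and3P[a3 b3 c3]] : exists r, [&& ~~ u r 0, u r m & ~~ u r m.+1].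
  pose S (w : 'I_n -> nat -> bool) := cnt w (fun x => [&& ~~ x 0, x m & ~~ x m.+1]).
  apply: (@cnt_gt0 _ u (fun x => [&& ~~ x 0, x m & ~~ x m.+1])).
  have e (w : 'I_n -> nat -> bool) :
    S w + cnt2 m w + cnt w (fun x => x m && x m.+1) = cnt w (fun x => x m) + cnt3 m w.
    rewrite /S /cnt2 /cnt3 /cnt -!big_split; apply: eq_bigr => r _ /=.
    by case: (w r 0); case: (w r m); case: (w r m.+1).
  by rewrite -/(S u); have := e u; have := e v; rewrite cm cmk Quv; move: Ruv; clear; lia.
have [r4 /and3P[a4 b4 c4]] : exists r, [&& ~~ u r 0, ~~ u r m & u r m.+1].
  pose S (w : 'I_n -> nat -> bool) := cnt w (fun x => [&& ~~ x 0, ~~ x m & x m.+1]).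
  apply: (@cnt_gt0 _ u (fun x => [&& ~~ x 0, ~~ x m & x m.+1])).
  have e (w : 'I_n -> nat -> bool) :
    S w + cnt w (fun x => x 0 && x m.+1) + cnt w (fun x => x m && x m.+1)
      = cnt w (fun x => x m.+1) + cnt3 m w.
    rewrite /S /cnt2 /cnt3 /cnt -!big_split; apply: eq_bigr => r _ /=.
    by case: (w r 0); case: (w r m); case: (w r m.+1).
  by rewrite -/(S u); have := e u; have := e v; rewrite ck c0k cmk; move: Ruv; clear; lia.
have ne c a b : u a c -> ~~ u b c -> (a != b) * (b != a).
  by move=> ua ub; have h : a != b by [apply: contraTneq ua => ->]; rewrite h eq_sym h.
have uq : uniq [:: r1; r2; r3; r4].
  by rewrite /= !inE !negb_or (ne _ _ _ b1 b2) (ne _ _ _ a1 a3) (ne _ _ _ a1 a4)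
    (ne _ _ _ a2 a3) (ne _ _ _ a2 a4) (ne _ _ _ b3 b4).
have [e1 e2 e3 e4] := dtE uq.
pose u' := swp (inner 0 m.+1) (dt r1 r2 r3 r4) u.
have o r : u' r 0 = u r 0 by rewrite /u' swp_out.
have i r : u' r m = u (dt r1 r2 r3 r4 r) m.
  by rewrite /u' swp_in // /inner m0 ltnSn.
have k r : u' r m.+1 = u r m.+1 by rewrite /u' swp_out // /inner ltnn andbF.
(* Rows [r3] and [r4] have entry 0 at column [0] and enter neither count, so only [r1] and [r2]
   matter. *)
have other (p : (nat -> bool) -> bool) : (forall x y : nat -> bool,
    x 0 = y 0 -> (y 0 -> x m = y m) -> x m.+1 = y m.+1 -> p x = p y) ->
  forall r, r != r1 -> r != r2 -> p (u' r) = p (u r).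
  move=> hp r n1 n2; apply: hp; rewrite ?o ?k // i.
  by case: (dtP r uq) n1 n2; rewrite ?eqxx // ?(negPf a3) ?(negPf a4).
have n12 := (ne _ _ _ b1 b2).1.
exists u'; split.
(* Column [0] is invariant, so a double exchange from [m + 1] on amounts to one on columns [1] to
   [m]. *)
- apply: (@conn_compl _ _ (fun c => m.+1 <= c)); first exact: dtK.
    move=> r c cN; rewrite /inner => h.
    have -> : c = 0 by move: h; clear; lia.
    case: (dtP r uq) => //; rewrite ?a1 ?a2 //; by rewrite (negPf a3) (negPf a4).
  apply: (flip_outer hN) => //=; first by rewrite ltnS m0.
  + by rewrite /pairing a1 a2 (negPf a3) (negPf a4).
  + by rewrite /pairing b1 b3 (negPf b2) (negPf b4).
  + by rewrite /pairing c1 c4 (negPf c2) (negPf c3).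
- by move=> r c cN hc; rewrite /u' swp_out //; move: hc; idx.
- have := @cnt_change2 n u u' (fun x => x 0 && x m) r1 r2 n12 (other _ _).
  rewrite /= !o !i e1 e2 a1 b1 a2 (negPf b2) /= !addn0 => h.
  by apply: (@addIn 1); rewrite -[RHS]h // => x y -> h' _; case: (y 0) h' => // ->.
have := @cnt_change2 n u u' (fun x => [&& x 0, x m & x m.+1]) r1 r2 n12 (other _ _).
rewrite /= !o !i !k e1 e2 a1 b1 a2 c1 (negPf b2) (negPf c2) /= !addn0 addn1; apply.
by move=> x y -> h' ->; case: (y 0) h' => // ->.
Qed.

End Descent.

(** * Induction on the number of columns left to match *)

Section Connectivity.

Set Implicit Arguments.
Unset Strict Implicit.
Unset Printing Implicit Defensive.

Variables (N n : nat).
Hypothesis hN : 3 < N.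
Implicit Types u v : 'I_n -> nat -> bool.
Local Notation conn := (@conn N n).
Local Notation same := (@same N n).

Lemma same_sym u v : same u v -> same v u.
Proof. by move=> h W cW y; rewrite h. Qed.

Lemma same_trans v u w : same u v -> same v w -> same u w.
Proof. by move=> h1 h2 W cW y; rewrite h1 ?h2. Qed.

Section Descend.
Variables (P : ('I_n -> nat -> bool) -> Prop) (M : ('I_n -> nat -> bool) -> nat).
Variables (m : nat) (v : 'I_n -> nat -> bool).
Hypothesis step : forall u, same u v -> eq_off N m u v -> P u -> M v < M u ->
  exists u', [/\ conn u u', eq_off N m u' u, P u' & (M u').+1 = M u].

(** Each step lowers [M] by exactly one, so the descent cannot jump over [M v]; [P] preserves what
    has been achieved before. *)
Lemma descend u : same u v -> eq_off N m u v -> P u -> M v <= M u ->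
  exists u', [/\ conn u u', eq_off N m u' v, P u' & M u' = M v].
Proof.
have [d] := ubnP (M u - M v); elim: d u => // d IH u; rewrite ltnS => hd uv off Pu.
rewrite leq_eqVlt => /orP[/eqP Muv|Mvu].
  by exists u; split=> //; apply: conn_refl.
have [u1 [c1 off1 P1 M1]] := step uv off Pu Mvu.
have [||||u2 [c2 off2 P2 M2]] := IH u1 _ _ _ P1.
- by move: Mvu hd; rewrite -M1; clear; lia.
- exact: same_trans (same_sym (conn_same hN c1)) uv.
- exact: eq_off_trans off1 off.
- by rewrite -ltnS M1.
by exists u2; split=> //; apply: conn_trans c2.
Qed.

End Descend.

Lemma balance_cnt2 u v m : same u v -> eq_off N m u v -> 0 < m -> m.+1 < N ->
  exists u' v', [/\ conn u u', conn v v', eq_off N m u' v' & cnt2 m u' = cnt2 m v'].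
Proof.
move=> uv off m0 mN.
(* The list with the larger count is the one that moves. *)
wlog le : u v uv off / cnt2 m v <= cnt2 m u => [th|].
  have [/(th _ _ uv off)//|/ltnW/(th _ _ (same_sym uv) (eq_off_sym off))] :=
    leqP (cnt2 m v) (cnt2 m u).
  by move=> [v' [u' [cv cu off' e]]]; exists u', v'; split=> //; apply: eq_off_sym.
have [||u' [cu off' _ e]] := @descend (fun=> True) (cnt2 m) m v _ u uv off _ le => //.
  move=> w wv offw _ h; have [w' [cw offw' e]] := cnt2_step hN wv offw m0 mN h.
  by exists w'.
by exists u', v; split=> //; apply: conn_refl.
Qed.

Lemma balance_cnt3 u v m : same u v -> eq_off N m u v -> 0 < m -> m.+1 < N ->
    cnt2 m u = cnt2 m v ->
  exists u' v', [/\ conn u u', conn v v', eq_off N m u' v', cnt2 m u' = cnt2 m v' &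
                    cnt3 m u' = cnt3 m v'].
Proof.
move=> uv off m0 mN Quv.
wlog le : u v uv off Quv / cnt3 m v <= cnt3 m u => [th|].
  have [/(th _ _ uv off Quv)//
    |/ltnW/(th _ _ (same_sym uv) (eq_off_sym off) (esym Quv))] :=
    leqP (cnt3 m v) (cnt3 m u).
  by move=> [v' [u' [cv cu off' e e']]]; exists u', v'; split=> //; apply: eq_off_sym.
have [|u' [cu off' e e']] :=
  @descend (fun w => cnt2 m w = cnt2 m v) (cnt3 m) m v _ u uv off Quv le.
  move=> w wv offw Qw h.
  have [w' [cw offw' Qe Re]] := cnt3_step hN wv offw m0 mN (esym Qw) h.
  by exists w'; rewrite Qe.
by exists u', v; split=> //; apply: conn_refl.
Qed.

(** The number of rows, the single and pair counts and [cnt3] determine the multiplicities of all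
    eight triples. *)
Lemma match_triples u v m : same u v -> eq_off N m u v -> m.+1 < N ->
    cnt2 m u = cnt2 m v -> cnt3 m u = cnt3 m v ->
  exists s : {perm 'I_n}, forall r,
    [/\ u r 0 = v (s r) 0, u r m = v (s r) m & u r m.+1 = v (s r) m.+1].
Proof.
move=> uv off mN Quv Ruv.
have c0 : cnt u (fun x => x 0) = cnt v (fun x => x 0).
  by apply: cnt_off off mN _ => x y ->.
have cm : cnt u (fun x => x m) = cnt v (fun x => x m).
  exact: (same_cnt_step hN (fun a _ => a) uv mN).
have ck : cnt u (fun x => x m.+1) = cnt v (fun x => x m.+1).
  by apply: cnt_off off mN _ => x y _ ->.
have c0k : cnt u (fun x => x 0 && x m.+1) = cnt v (fun x => x 0 && x m.+1).
  by apply: cnt_off off mN _ => x y -> ->.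
have cmk : cnt u (fun x => x m && x m.+1) = cnt v (fun x => x m && x m.+1).
  exact: (same_cnt_step hN andb uv mN).
pose K a b c (w : 'I_n -> nat -> bool) :=
  cnt w (fun x => (x 0, x m, x m.+1) == (a, b, c)).
have kE (w : 'I_n -> nat -> bool) :
  [/\ cnt3 m w = K true true true w,
      cnt2 m w = K true true true w + K true true false w,
      cnt w (fun x => x 0 && x m.+1) = K true true true w + K true false true w,
      cnt w (fun x => x m && x m.+1) = K true true true w + K false true true w &
  [/\ cnt w (fun x => x 0) = K true true true w + K true true false w
        + K true false true w + K true false false w,
      cnt w (fun x => x m) = K true true true w + K true true false w
        + K false true true w + K false true false w,
      cnt w (fun x => x m.+1) = K true true true w + K true false true w
        + K false true true w + K false false true w &
      n = K true true true w + K true true false w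
        + K true false true w + K true false false w
        + K false true true w + K false true false w
        + K false false true w + K false false false w]].
  have n1 : n = \sum_(r < n) 1 by rewrite sum1_card card_ord.
  do 2?split; rewrite ?[LHS]n1 /cnt3 /cnt2 /K /cnt -?big_split;
    apply: eq_bigr => r _ /=;
    by case: (w r 0); case: (w r m); case: (w r m.+1).
have Keq a b c : K a b c u = K a b c v.
  have [] := kE u; have [] := kE v; rewrite c0 cm ck c0k cmk Quv Ruv.
  move=> -> -> -> -> [-> -> -> nv] e1 e2 e3 e4 [e5 e6 e7]; rewrite {1}nv.
  move: e1 e2 e3 e4 e5 e6 e7; clear.
  by case: a; case: b; case: c; lia.
have [[[a b] c]|s sE] := @perm_of_counts _ n
  (fun r => (u r 0, u r m, u r m.+1)) (fun r => (v r 0, v r m, v r m.+1)).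
  exact: Keq.
by exists s => r; case: (sE r).
Qed.

(** In the step, [s] matches the triples at [0], [m + 1], [m + 2]. Permuting [u2] by [s] beyond
    column [m + 2], and [v2] everywhere, leaves lists that agree off columns [1] to [m]. *)
Lemma conn_of_eq_off u v m : m.+1 < N -> same u v -> eq_off N m u v -> conn u v.
Proof.
elim: m u v => [|m IH] u v mN uv off.
  by apply: conn_eq => r c cN; apply: off => //; case: c {cN}.
have [u1 [v1 [cu1 cv1 off1 Q1]]] := balance_cnt2 uv off (ltn0Sn m) mN.
have uv1 : same u1 v1.
  exact: same_trans (same_sym (conn_same hN cu1)) (same_trans uv (conn_same hN cv1)).
have [u2 [v2 [cu2 cv2 off2 Q2 R2]]] := balance_cnt3 uv1 off1 (ltn0Sn m) mN Q1.
have uv2 : same u2 v2.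
  exact: same_trans (same_sym (conn_same hN cu2)) (same_trans uv1 (conn_same hN cv2)).
have [s sE] := match_triples uv2 off2 mN Q2 R2.
apply: conn_trans cu1 _; apply: conn_trans cu2 _.
apply: conn_sym; apply: conn_trans cv1 _; apply: conn_trans cv2 _; apply: conn_sym.
have k0 : 0 < N by apply: ltn_trans mN.
(* On columns already matched, [s] acts alike on [u2] and [v2]; hence it preserves columns [0] and
   [m + 2] of [u2], the ends of the outer arc. *)
have su c r : c < N -> c = 0 \/ m.+2 <= c -> v2 (s r) c = u2 (s r) c.
  by move=> cN hc; rewrite off2 //; move: hc; clear; lia.
have cz : conn u2 (swp (fun c => m.+2 < c) s u2).
  apply: (conn_glue_outer hN) => // r; have [s0 _ sk] := sE r.
    by rewrite -su // -?s0 //; left.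
  by rewrite -su // -?sk //; right.
apply: conn_trans (cz) _.
have cs := conn_perm N v2 s.
apply: conn_trans _ (conn_sym cs); apply: IH.
- exact: ltnW.
- apply: same_trans (same_sym (conn_same hN cz)) _.
  exact: same_trans uv2 (conn_same hN cs).
move=> r c cN hc; have [s0 sm sk] := sE r.
have [ck|ck] := ltnP m.+2 c; first by rewrite swp_in // -su //; right; apply: ltnW.
rewrite swp_out -?leqNgt //.
have [->//|[->//|->//]] : c = 0 \/ c = m.+1 \/ c = m.+2.
by move: hc ck; clear; lia.
Qed.

(** The closing edge starts the induction: after a reordering, the lists agree at columns [0] and
    [N - 1]. *)
Lemma same_conn u v : same u v -> conn u v.
Proof.
move=> uv; have N0 : 0 < N by apply: leq_trans hN.
have [[a b]|s sE] := @perm_of_counts _ n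
    (fun r => (u r 0, u r N.-1)) (fun r => (v r 0, v r N.-1)).
  exact: (same_cnt_last hN (fun x y => (x, y) == (a, b)) uv).
have cs := conn_perm N v s.
apply: conn_trans _ (conn_sym cs); apply: (@conn_of_eq_off _ _ N.-2).
- by move: hN; clear; lia.
- exact: same_trans uv (conn_same hN cs).
move=> r c cN hc; have [s0 s1] := sE r.
have [->//|->//] : c = 0 \/ c = N.-1.
by move: hN cN hc; clear; lia.
Qed.

End Connectivity.

Lemma connected_of_same_marginals N (U V : table 'I_N) : 3 < N ->
    same_marginals (cycle_adj N) U V ->
  connected_by (B2 N `|` B4 N)%classic U V.
Proof.
move=> hN UV; pose s0 : state 'I_N := [ffun=> false].
have [l lE] := table_rows U; have [l' lE'] := table_rows V.
have sizeE (W : state 'I_N -> nat) k : (forall s, count_mem s k = W s) ->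
    size k = \sum_s W s.
  move=> kE; under eq_bigr => s _ do rewrite -kE.
  rewrite -sum1_size; under [RHS]eq_bigr => s _ do rewrite -sum1_count big_mkcond.
  rewrite exchange_big; apply: eq_bigr => x _ /=.
  by rewrite (bigD1 x) //= eqxx big1 ?addn0 // => s /negPf sx; rewrite eq_sym sx.
(* The marginal on the empty clique is the total of the table. *)
have sz : size l' = size l.
  rewrite (sizeE _ _ lE) (sizeE _ _ lE').
  have c0 : clique (cycle_adj N) finset.set0 by move=> i j; rewrite inE.
  have e (W : table 'I_N) :
      marginal W (restr finset.set0 s0) = \sum_s W s.
    apply: eq_bigl => s; apply/eqP; apply: restr_eq => v; by rewrite inE.
  by rewrite -!e UV.
(* Rows are padded with [false] beyond column [N - 1], which [st] discards. *)
pose rows k (r : 'I_(size l)) (c : nat) : bool :=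
  if insub c is Some c' then nth s0 k r c' else false.
have tabE (W : table 'I_N) k : size k = size l ->
    (forall s, count_mem s k = W s) -> tab N (rows k) = W.
  move=> ks kE; apply/ffunP => s; rewrite ffunE -kE.
  rewrite -sum1_count (big_nth s0) big_mkord ks [RHS]big_mkcond.
  apply: eq_bigr => r _; rewrite (_ : st N (rows k r) = nth s0 k r).
    by rewrite /=; case: eqP.
  by apply/ffunP => c; rewrite ffunE /rows valK.
move: UV; rewrite -(tabE U l) // -(tabE V l') //.
exact: same_conn.
Qed.

Theorem theorem5p1 (N : nat) (hN : (4 <= N)%N) :
  markov_basis (cycle_adj N) (B2 N `|` B4 N)%classic.
Proof.
split.
- by rewrite finite_setU; split; [apply: finite_B2|apply: finite_B4].
- by move=> m [/(B2_kernel hN)|/(B4_kernel hN)].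
- by move=> u v; apply: connected_of_same_marginals.
Qed.
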